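(* There exists a reflexive Banach space $X$ with an unconditional basis which admits $\ell^1$ as an $\omega$-spreading model and does not admit $\ell^1$ as a plegma block generated spreading model of any order $\xi$, $1\le\xi<\omega_1$ (with respect to that basis).
   Context: $\mathbb{N}=\{1,2,\dots\}$. For $M\subseteq\mathbb{N}$ infinite, $M(k)$ is its $k$-th element; for a finite set $s$, $s(k)$ is its $k$-th element; $t\sqsubseteq s$ means initial segment. For a family $\mathcal{F}$ of finite subsets of $\mathbb{N}$ let $\widehat{\mathcal{F}}=\{t:\exists s\in\mathcal{F},\ t\sqsubseteq s\}$ and $\mathcal{F}\upharpoonright M=\{s\in\mathcal{F}:s\subseteq M\}$. $\mathcal{F}$ is thin if no element is a proper initial segment of another. A family is regular if it is hereditary (closed under subsets), spreading (if $\{n_1<\dots<n_k\}$ is in it, $m_1<\dots<m_k$, $n_i\le m_i$ for all $i$, then $\{m_1,\dots,m_k\}$ is in it) and compact (its characteristic functions form a closed subset of $\{0,1\}^{\mathbb{N}}$). $\mathcal{F}$ is regular thin if it is thin and $\widehat{\mathcal{F}}$ is regular. The order $o(\mathcal{F})$ is the (countable) rank of the well-founded tree $\widehat{\mathcal{F}}$: maximal elements have rank $0$, the rank of $s$ is $\sup\{\mathrm{rank}(t)+1: t\in\widehat{\mathcal{F}},\ s\sqsubset t\}$, and $o(\mathcal{F})$ is the rank of $\emptyset$. (E.g. $\{s:|s|=\min s\}$ has order $\omega$.) A tuple $(s_1,\dots,s_l)$ of nonempty finite subsets of $\mathbb{N}$ is plegma if $s_i(k)<s_j(k)$ whenever $i<j$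 and $k\le\min(|s_i|,|s_j|)$, and $s_i(k)<s_j(k+1)$ for all $i,j$ and $k\le\min(|s_i|,|s_j|-1)$. An $\mathcal{F}$-subsequence $(x_s)_{s\in\mathcal{F}\upharpoonright M}$ in a Banach space $X$ ($M\subseteq\mathbb{N}$ infinite) is a map $s\mapsto x_s$ from $\mathcal{F}\upharpoonright M$ to $X$. Let $(e_n)_n$ be a Hamel basis of an infinite-dimensional seminormed space with seminorm $\|\cdot\|_*$. $(x_s)_{s\in\mathcal{F}\upharpoonright M}$ generates $(e_n)_n$ as an $\mathcal{F}$-spreading model if there is a null sequence $(\delta_n)_n$ of positive reals such that $\big|\,\|\sum_{j=1}^k a_jx_{s_j}\|-\|\sum_{j=1}^k a_je_j\|_*\big|\le\delta_l$ for all $1\le k\le l$, all plegma $k$-tuples $(s_j)_{j=1}^k$ in $\mathcal{F}\upharpoonright M$ with $s_1(1)\ge M(l)$ and all $a_1,\dots,a_k\in[-1,1]$. $X$ admits $\ell^1$ as a $\xi$-spreading model (spreading model of order $\xi$) if some $\mathcal{F}$-subsequence in $X$, with $\mathcal{F}$ regular thin and $o(\mathcal{F})=\xi$, generates a sequence $(e_n)_n$ equivalent to the usual basis of $\ell^1$; it admits $\ell^1$ as a plegma block generated spreading model of order $\xi$ if such an $\mathcal{F}$-subsequence can be chosen plegma block. For $X$ with a Schauder basis (a fixed enumeration of the basis), an $\mathcal{F}$-subsequence $(x_s)_{s\in\mathcal{F}\upharpoonright M}$ is plegma block if all $x_s$ are finitely supported and $\mathrm{supp}(x_{s_1})<\mathrm{supp}(x_{s_2})$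 (i.e. $\max<\min$) for every plegma pair $(s_1,s_2)$ in $\mathcal{F}\upharpoonright M$. *)

(* Defs.v *)
From HB Require Import structures.
From mathcomp Require Import all_boot all_order all_algebra finmap.
From mathcomp Require Import all_classical all_reals all_analysis.

Set Implicit Arguments.
Unset Strict Implicit.
Unset Printing Implicit Defensive.

Import Order.TTheory GRing.Theory Num.Theory.
Import numFieldNormedType.Exports.

Local Open Scope classical_set_scope.
Local Open Scope ring_scope.

(* The set {1, 2, ...} enters only through its order, so it is encoded by the
   order-isomorphic type nat; all one-based indices of the mathematical text
   (the k-th element of s or M, e_k, delta_l) become zero-based.  An infinite
   set M is given by its strictly increasing enumeration m : nat -> nat. *)

(** * Countable ordinals *)

(* [OSup f] denotes the supremum of the ordinals [f i + 1].  Every term denotes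
   an ordinal below omega_1 and every such ordinal is denoted; two terms denote
   the same ordinal when they are related by [oeq]. *)
Inductive cord : Type :=
| OZero : cord
| OSup : (nat -> cord) -> cord.

Fixpoint ole (a b : cord) {struct a} : Prop :=
  match a with
  | OZero => True
  | OSup f => forall i,
      match b with
      | OZero => False
      | OSup g => exists j, ole (f i) (g j)
      end
  end.

Definition oeq (a b : cord) : Prop := ole a b /\ ole b a.

Definition osucc (a : cord) : cord := OSup (fun=> a).

Definition ofin (n : nat) : cord := iter n osucc OZero.

Definition oomega : cord := OSup ofin.

Definition is_osup (A : set cord) (a : cord) : Prop :=
  (forall b, A b -> ole b a) /\
  (forall c, (forall b, A b -> ole b c) -> ole a c).

(** * Families of finite sets of natural numbers *)

Definition elems (s : {fset nat}) : seq nat := sort leq (enum_fset s).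

Definition elem (s : {fset nat}) (k : nat) : nat := nth 0%N (elems s) k.

Definition initial (t s : {fset nat}) : bool := prefix (elems t) (elems s).

Definition proper_initial (t s : {fset nat}) : bool := initial t s && (t != s).

Definition hat (F : set {fset nat}) : set {fset nat} :=
  [set t | exists2 s, F s & initial t s].

Definition restr (F : set {fset nat}) (m : nat -> nat) : set {fset nat} :=
  [set s | F s /\ forall i, i \in s -> range m i].

Definition thin (F : set {fset nat}) : Prop :=
  forall s t, F s -> F t -> ~~ proper_initial s t.

Definition hereditary (F : set {fset nat}) : Prop :=
  forall s t : {fset nat}, F s -> (t `<=` s)%fset -> F t.

Definition spreading (F : set {fset nat}) : Prop :=
  forall s t : {fset nat}, F s -> #|` t| = #|` s| ->
    (forall k, (k < #|` s|)%N -> (elem s k <= elem t k)%N) -> F t.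

Definition char_fun (s : {fset nat}) : cantor_space := fun n => n \in s.

Definition compact_family (F : set {fset nat}) : Prop :=
  closed [set char_fun s | s in F].

Definition regular (F : set {fset nat}) : Prop :=
  [/\ hereditary F, spreading F & compact_family F].

Definition regular_thin (F : set {fset nat}) : Prop :=
  thin F /\ regular (hat F).

(* Maximal elements of the tree get rank zero, being assigned the supremum of
   the empty set. *)
Definition is_rank (F : set {fset nat}) (rk : {fset nat} -> cord) : Prop :=
  forall s, hat F s ->
    is_osup [set osucc (rk t) | t in [set t | hat F t /\ proper_initial s t]]
            (rk s).

(* Requiring the empty set to be a node amounts to excluding the empty family,
   whose tree has no root and hence no order. *)
Definition has_order (F : set {fset nat}) (xi : cord) : Prop :=
  hat F fset0 /\ exists2 rk, is_rank F rk & oeq (rk fset0) xi.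

Definition plegma (k : nat) (s : k.-tuple {fset nat}) : Prop :=
  [/\ forall i, tnth s i != fset0,
      forall (i j : 'I_k) (n : nat), (i < j)%N ->
        (n < minn #|` tnth s i| #|` tnth s j|)%N ->
        (elem (tnth s i) n < elem (tnth s j) n)%N
    & forall (i j : 'I_k) (n : nat),
        (n < minn #|` tnth s i| #|` tnth s j|.-1)%N ->
        (elem (tnth s i) n < elem (tnth s j) n.+1)%N].

(** * Spreading models *)

Definition is_seminorm (R : realType) (E : lmodType R) (p : E -> R) : Prop :=
  (forall u v, p (u + v) <= p u + p v) /\ (forall a u, p (a *: u) = `|a| * p u).

Definition hamel_basis (R : realType) (E : lmodType R) (e : nat -> E) : Prop :=
  (forall (n : nat) (a : 'I_n -> R),
      \sum_(i < n) a i *: e i = 0 -> forall i, a i = 0) /\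
  (forall u, exists (n : nat) (a : 'I_n -> R), u = \sum_(i < n) a i *: e i).

Definition equiv_l1_basis (R : realType) (E : lmodType R) (p : E -> R)
    (e : nat -> E) : Prop :=
  exists c C : R, [/\ 0 < c, 0 < C &
    forall (n : nat) (a : 'I_n -> R),
      c * (\sum_(i < n) `|a i|) <= p (\sum_(i < n) a i *: e i) /\
      p (\sum_(i < n) a i *: e i) <= C * (\sum_(i < n) `|a i|)].

(* An F-subsequence indexed by the members of F contained in M is represented
   by a total map x, whose other values are never used. *)
Definition generates (R : realType) (X : normedModType R)
    (F : set {fset nat}) (m : nat -> nat) (x : {fset nat} -> X)
    (E : lmodType R) (p : E -> R) (e : nat -> E) : Prop :=
  exists delta : nat -> R,
    [/\ forall n, 0 < delta n,
        delta @ \oo --> (0 : R)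
      & forall (k l : nat) (s : k.+1.-tuple {fset nat}) (a : 'I_k.+1 -> R),
          (k <= l)%N ->
          (forall j, restr F m (tnth s j)) -> plegma s ->
          (m l <= elem (tnth s ord0) 0)%N ->
          (forall j, -1 <= a j <= 1) ->
          `| `|\sum_(j < k.+1) a j *: x (tnth s j)|
             - p (\sum_(j < k.+1) a j *: e j) | <= delta l].

Definition generates_l1 (R : realType) (X : normedModType R)
    (F : set {fset nat}) (m : nat -> nat) (x : {fset nat} -> X) : Prop :=
  exists (E : lmodType R) (p : E -> R) (e : nat -> E),
    [/\ is_seminorm p, hamel_basis e, generates F m x p e
      & equiv_l1_basis p e].

Definition admits_l1 (R : realType) (X : normedModType R) (xi : cord) : Prop :=
  exists (F : set {fset nat}) (m : nat -> nat) (x : {fset nat} -> X),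
    [/\ regular_thin F, has_order F xi, {homo m : i j / (i < j)%N}
      & generates_l1 F m x].

(** * Bases *)

Definition expansion (R : realType) (X : normedModType R) (b : nat -> X)
    (x : X) (a : nat -> R) : Prop :=
  series (fun n => a n *: b n) @ \oo --> x.

Definition schauder_basis (R : realType) (X : normedModType R)
    (b : nat -> X) : Prop :=
  forall x, exists! a, expansion b x a.

Definition unconditional_basis (R : realType) (X : normedModType R)
    (b : nat -> X) : Prop :=
  schauder_basis b /\
  forall x a, expansion b x a ->
    forall sigma : nat -> nat, bijective sigma ->
      series (fun n => a (sigma n) *: b (sigma n)) @ \oo --> x.

Definition supp (R : realType) (X : normedModType R) (b : nat -> X) (x : X) :
    set nat :=
  [set n | exists2 a, expansion b x a & a n != 0].

Definition plegma_block (R : realType) (X : normedModType R) (b : nat -> X)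
    (F : set {fset nat}) (m : nat -> nat) (x : {fset nat} -> X) : Prop :=
  (forall s, restr F m s -> finite_set (supp b (x s))) /\
  (forall s1 s2, restr F m s1 -> restr F m s2 -> plegma [tuple s1; s2] ->
     forall i j, supp b (x s1) i -> supp b (x s2) j -> (i < j)%N).

Definition admits_l1_plegma_block (R : realType) (X : normedModType R)
    (b : nat -> X) (xi : cord) : Prop :=
  exists (F : set {fset nat}) (m : nat -> nat) (x : {fset nat} -> X),
    [/\ regular_thin F, has_order F xi, {homo m : i j / (i < j)%N},
        plegma_block b F m x & generates_l1 F m x].

(** * Reflexivity *)

Definition dual (R : realType) (X : normedModType R) : set (X -> R^o) :=
  [set f | linear f /\ continuous f].

Definition dual_norm (R : realType) (X : normedModType R) (f : X -> R^o) : R :=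
  sup [set `|f x| | x in [set x | `|x| <= 1]].

(* Surjectivity of the canonical embedding of X into its bidual; phi ranges
   over the bounded linear functionals on the dual space and its values
   outside the dual are irrelevant. *)
Definition reflexive_space (R : realType) (X : normedModType R) : Prop :=
  forall phi : (X -> R^o) -> R,
    (forall a f g, dual f -> dual g -> phi (a *: f + g) = a * phi f + phi g) ->
    (exists C : R, forall f, dual f -> `|phi f| <= C * dual_norm f) ->
    exists x, forall f, dual f -> phi f = f x.

(* Main.v *)
(* If blocks u_1 < ... < u_n of a basis satisfy an upper 2-estimate
   |u_1 + ... + u_n| <= C sqrt n max_i |u_i|, then plegma block subsequences
   cannot generate l1, since l-tuples far out would be l blocks equivalent to
   the basis of l1^l; the same estimate makes the basis shrinking.  So it
   suffices to build a boundedly complete unconditional basis with such an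
   estimate in which some non-block subsequence of order omega generates l1.

   Basis elements carry a level and a block number (the exponents of 2 and 3 in
   their index).  For s with |s| = min s + 1 let x_s be the sum over i < |s| of
   the basis element with level i, block number min s and position increasing
   with s(i).  If s_1, ..., s_{k+1} is plegma, then the supports of the x_{s_j}
   interlace level by level: the row formed by the (k+1) nodes of level i
   precedes the row of level i + 1.  The norm contains the terms

     ((k+1)^-2 * \sum_(rows A) (\sum_(t in A) |x t|)^2)^(1/2)

   over (k+1)^2 successive rows of at most k+1 nodes of a common level; they
   give |sum_j a_j x_{s_j}| = sum_j |a_j|.  A division of nat into intervals
   splits at most two rows per interval, and since rows are so short compared
   with their number, the split rows cost no more than the sup norm: this is the
   upper 2-estimate.  Finally l2-sums over disjoint sets of block numbers,
   together with a weighted l2-norm, yield bounded completeness without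
   affecting |x_s| = 1, because x_s lives on a single block number. *)
From HB Require Import structures.
Require Import Defs.
From mathcomp Require Import all_boot all_order all_algebra finmap.
From mathcomp Require Import all_classical all_reals all_analysis.
From mathcomp Require Import ring lra zify.

Set Implicit Arguments.
Unset Strict Implicit.
Unset Printing Implicit Defensive.

Import Order.TTheory GRing.Theory Num.Theory.
Import numFieldNormedType.Exports.

Local Open Scope classical_set_scope.
Local Open Scope ring_scope.

(** * Norms defined by families of quadratic gauges *)

Lemma cauchy_schwarz_seq (R : realFieldType) (T : eqType) (s : seq T)
    (w a b : T -> R) : (forall i, i \in s -> 0 <= w i) ->
  (\sum_(i <- s) w i * a i * b i) ^+ 2 <=
  (\sum_(i <- s) w i * a i ^+ 2) * (\sum_(i <- s) w i * b i ^+ 2).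
Proof.
move=> w0; set S := \sum_(i <- s) w i * a i * b i.
set P := \sum_(i <- s) _ * a _ ^+ _; set Q := \sum_(i <- s) _.
have quad u v : 0 <= u ^+ 2 * P + 2 * u * v * S + v ^+ 2 * Q.
  rewrite [X in 0 <= X](_ : _ = \sum_(i <- s) w i * (u * a i + v * b i) ^+ 2).
    by rewrite big_seq sumr_ge0// => i /w0 wi; rewrite mulr_ge0// sqr_ge0.
  by rewrite !mulr_sumr -!big_split/=; apply: eq_bigr => i _; ring.
have P0 : 0 <= P by have := quad 1 0; lra.
have Q0 : 0 <= Q by have := quad 0 1; lra.
have [Qp|Qn] := ltP 0 Q.
  (* The choice u = Q, v = -S turns the form into [Q * (P * Q - S ^+ 2)], and Q > 0 cancels; the
     case P > 0 below is symmetric. *)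
  have := quad Q (- S).
  rewrite (_ : _ + _ = Q * (P * Q - S ^+ 2)); last by ring.
  by rewrite pmulr_rge0// subr_ge0.
have Q00 : Q = 0 by lra.
have [Pp|Pn] := ltP 0 P.
  have := quad (- S) P.
  rewrite (_ : _ + _ = P * (P * Q - S ^+ 2)); last by ring.
  by rewrite pmulr_rge0// subr_ge0.
have P00 : P = 0 by lra.
(* With P = Q = 0 the form is 2uvS, which is nonnegative for both signs of v only if S = 0. *)
have := quad 1 1; have := quad 1 (-1); rewrite P00 Q00 => ? ?.
have -> : S = 0 by lra.
by rewrite expr0n mulr0.
Qed.

Section Gauges.
Variable R : realType.
Implicit Types (x y : nat -> R^o) (g : seq (R * seq nat)).

Definition rowsum x (A : seq nat) : R := \sum_(t <- A) `|x t|.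

(** A gauge is a finite list of weighted rows. For nonnegative weights the root of [qf g] is a
    weighted l2-sum of l1-norms over the rows, hence a lattice seminorm that sees finitely many
    coordinates. *)
Definition qf g x : R := \sum_(c <- g) c.1 * rowsum x c.2 ^+ 2.

Definition nonneg g : Prop := forall c, c \in g -> 0 <= c.1.

Definition delta_seq (n : nat) : nat -> R^o := fun k => (k == n)%:R.

Lemma rowsum_ge0 x A : 0 <= rowsum x A.
Proof. exact: sumr_ge0. Qed.

Lemma ler_rowsum x y A : {in A, forall t, `|x t| <= `|y t|} ->
  rowsum x A <= rowsum y A.
Proof. by move=> xy; rewrite /rowsum !big_seq ler_sum. Qed.

Lemma rowsumD x y A : rowsum (x + y) A <= rowsum x A + rowsum y A.
Proof. by rewrite /rowsum -big_split/= ler_sum// => t _; exact: ler_normD. Qed.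

Lemma rowsumZ a x A : rowsum (a *: x) A = `|a| * rowsum x A.
Proof.
by rewrite /rowsum mulr_sumr; apply: eq_bigr => t _; rewrite -normrM.
Qed.

Lemma qf_ge0 g x : nonneg g -> 0 <= qf g x.
Proof.
by move=> g0; rewrite /qf big_seq sumr_ge0// => c /g0 c0; rewrite mulr_ge0// sqr_ge0.
Qed.

Lemma ler_qf g x y : nonneg g -> (forall t, `|x t| <= `|y t|) ->
  qf g x <= qf g y.
Proof.
move=> g0 xy; rewrite /qf !big_seq ler_sum// => c /g0 c0.
by rewrite ler_wpM2l// lerXn2r ?nnegrE ?rowsum_ge0// ler_rowsum.
Qed.

Lemma qfZ g a x : qf g (a *: x) = `|a| ^+ 2 * qf g x.
Proof.
by rewrite /qf mulr_sumr; apply: eq_bigr => c _; rewrite rowsumZ exprMn mulrCA.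
Qed.

Lemma qf_cauchy_schwarz g x y : nonneg g ->
  \sum_(c <- g) c.1 * rowsum x c.2 * rowsum y c.2 <=
  Num.sqrt (qf g x) * Num.sqrt (qf g y).
Proof.
move=> g0; rewrite -sqrtrM ?qf_ge0// -[leLHS]ger0_norm.
  by rewrite -sqrtr_sqr ler_wsqrtr// cauchy_schwarz_seq.
by rewrite big_seq sumr_ge0// => c /g0 c0; rewrite !mulr_ge0// rowsum_ge0.
Qed.

Lemma sqrt_qfD g x y : nonneg g ->
  Num.sqrt (qf g (x + y)) <= Num.sqrt (qf g x) + Num.sqrt (qf g y).
Proof.
move=> g0; rewrite -[leRHS]ger0_norm ?addr_ge0 ?sqrtr_ge0//.
rewrite -[leRHS]sqrtr_sqr ler_wsqrtr// sqrrD !sqr_sqrtr ?qf_ge0//.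
have CS := qf_cauchy_schwarz x y g0.
apply: (@le_trans _ _ (qf g x +
    (\sum_(c <- g) c.1 * rowsum x c.2 * rowsum y c.2) *+ 2 + qf g y)); last first.
  by rewrite lerD2r lerD2l lerMn2r/=.
rewrite /qf -sumrMnl -!big_split/= !big_seq ler_sum// => c /g0 c0.
rewrite [leRHS](_ : _ = c.1 * (rowsum x c.2 + rowsum y c.2) ^+ 2); last by ring.
by rewrite ler_wpM2l// lerXn2r ?nnegrE ?addr_ge0 ?rowsum_ge0// rowsumD.
Qed.

(** [gset_coord] makes the norm dominate every coordinate, which gives definiteness and continuous
    coordinates; [gset_unit] puts the unit vectors into the unit ball. *)
Record gfam := GFam {
  gset :> seq (R * seq nat) -> Prop ;
  gset_nonneg : forall g, gset g -> nonneg g ;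
  gset_coord : forall n, exists2 g, gset g & forall x, x n ^+ 2 <= qf g x ;
  gset_unit : forall n g, gset g -> qf g (delta_seq n) <= 1 }.

Variable G : gfam.

Definition gbounded : {pred (nat -> R^o)} :=
  mem [set x | exists c : R, forall g, G g -> qf g x <= c].

Definition gnorm x : R := Num.sqrt (sup [set qf g x | g in G]).

Lemma gboundedP x :
  reflect (exists2 c : R, 0 <= c & forall g, G g -> qf g x <= c ^+ 2)
    (x \in gbounded).
Proof.
apply: (iffP idP); rewrite /gbounded inE/=.
  move=> [c xc]; have c0 : 0 <= c.
    have [g Gg _] := gset_coord G 0.
    by rewrite (le_trans _ (xc _ Gg))// qf_ge0//; exact: gset_nonneg Gg.
  by exists (Num.sqrt c); [exact: sqrtr_ge0 | rewrite sqr_sqrtr].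
by move=> [c c0 xc]; exists (c ^+ 2).
Qed.

Lemma gnorm_ge0 x : 0 <= gnorm x.
Proof. exact: sqrtr_ge0. Qed.

(** Outside [gbounded] the supremum in [gnorm] is a default value, so a bound on [gnorm x] is
    informative only together with membership; hence the conjunction. *)
Lemma gnormP x c : 0 <= c ->
  (x \in gbounded /\ gnorm x <= c) <-> (forall g, G g -> qf g x <= c ^+ 2).
Proof.
move=> c0; split=> [[/gboundedP[d d0 xd] xc] g Gg|xc].
  have sx : has_sup [set qf g x | g in G].
    split; first by exists (qf g x), g.
    by exists (d ^+ 2) => _ [h Gh <-]; exact: xd.
  have : qf g x <= gnorm x ^+ 2.
    have qle : qf g x <= sup [set qf g x | g in G].
      by apply: sup_upper_bound => //; exists g.
    rewrite sqr_sqrtr// (le_trans _ qle)// qf_ge0//; exact: gset_nonneg Gg.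
  by move=> /le_trans; apply; rewrite lerXn2r ?nnegrE ?gnorm_ge0.
split; first by apply/gboundedP; exists c.
rewrite /gnorm -[leRHS]ger0_norm// -sqrtr_sqr ler_wsqrtr//.
apply: ge_sup; last by move=> _ [g Gg <-]; exact: xc.
by have [g Gg _] := gset_coord G 0; exists (qf g x), g.
Qed.

Lemma qf_gnorm g x : G g -> x \in gbounded -> qf g x <= gnorm x ^+ 2.
Proof. by move=> Gg bx; apply: (gnormP x (gnorm_ge0 x)).1 Gg. Qed.

Lemma sqrt_qf_gnorm g x : G g -> x \in gbounded -> Num.sqrt (qf g x) <= gnorm x.
Proof.
move=> Gg bx; rewrite -[leRHS]ger0_norm ?gnorm_ge0// -sqrtr_sqr ler_wsqrtr//.
exact: qf_gnorm.
Qed.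

Lemma gnorm_le x c : 0 <= c -> (forall g, G g -> qf g x <= c ^+ 2) ->
  gnorm x <= c.
Proof. by move=> c0 /(gnormP x c0)[]. Qed.

Lemma gnorm_sub x y : y \in gbounded -> (forall t, `|x t| <= `|y t|) ->
  x \in gbounded /\ gnorm x <= gnorm y.
Proof.
move=> by_ xy; apply/(gnormP x (gnorm_ge0 y)) => g Gg.
apply: le_trans (qf_gnorm Gg by_).
by apply: ler_qf => //; exact: gset_nonneg Gg.
Qed.

Lemma gnormD_ex x y : x \in gbounded -> y \in gbounded ->
  x + y \in gbounded /\ gnorm (x + y) <= gnorm x + gnorm y.
Proof.
move=> bx by_; apply/gnormP; first by rewrite addr_ge0 ?gnorm_ge0.
move=> g Gg; have g0 := gset_nonneg Gg.
rewrite -[leLHS]sqr_sqrtr ?qf_ge0//.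
rewrite lerXn2r ?nnegrE ?sqrtr_ge0 ?addr_ge0 ?gnorm_ge0//.
by rewrite (le_trans (sqrt_qfD _ _ g0))// lerD// sqrt_qf_gnorm.
Qed.

Lemma gnormZ_ex a x : x \in gbounded ->
  a *: x \in gbounded /\ gnorm (a *: x) <= `|a| * gnorm x.
Proof.
move=> bx; apply/gnormP; first by rewrite mulr_ge0 ?gnorm_ge0.
by move=> g Gg; rewrite qfZ exprMn ler_wpM2l ?sqr_ge0// qf_gnorm.
Qed.

Lemma coord_le_gnorm x n : x \in gbounded -> `|x n| <= gnorm x.
Proof.
move=> bx; have [g Gg xg] := gset_coord G n.
have := le_trans (xg x) (qf_gnorm Gg bx).
by rewrite -real_normK ?num_real// ler_pXn2r ?nnegrE ?gnorm_ge0.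
Qed.

Lemma gbounded_submod_closed : submod_closed gbounded.
Proof.
split.
  apply/gboundedP; exists 0 => // g Gg.
  by rewrite -(scale0r (0 : nat -> R^o)) qfZ normr0 expr0n mul0r.
move=> a x y bx by_.
have [bax _] := gnormZ_ex a bx; exact: (gnormD_ex bax by_).1.
Qed.

HB.instance Definition _ :=
  GRing.isSubmodClosed.Build _ _ gbounded gbounded_submod_closed.

(** The space consists of all sequences with bounded gauges, not only of the closed span of the unit
    vectors; the two agree once [tails_vanish] holds. *)
Record gspace := GSpace { gval : nat -> R^o ; gvalP : gval \in gbounded }.

HB.instance Definition _ := [isSub for gval].
HB.instance Definition _ := [Choice of gspace by <:].
HB.instance Definition _ := [SubChoice_isSubLmodule of gspace by <:].

End Gauges.

(** * The Banach space defined by a gauge family *)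

Section GspaceNormed.
Variables (R : realType) (G : gfam R).

Definition gspace_norm (x : gspace G) : R := gnorm G (gval x).

Fact gspace_normD (x y : gspace G) :
  gspace_norm (x + y) <= gspace_norm x + gspace_norm y.
Proof. exact: (gnormD_ex (gvalP x) (gvalP y)).2. Qed.

Fact gspace_normZ (a : R) (x : gspace G) :
  gspace_norm (a *: x) = `|a| * gspace_norm x.
Proof.
apply/eqP; rewrite eq_le (gnormZ_ex a (gvalP x)).2/=.
have [->|a0] := eqVneq a 0; first by rewrite normr0 mul0r gnorm_ge0.
(* The reverse inequality is the direct one for the scalar [a^-1] and the vector [a *: x]. *)
have := (gnormZ_ex a^-1 (gvalP (a *: x))).2.
rewrite (_ : a^-1 *: _ = gval x); last first.
  by rewrite (_ : gval (a *: x) = a *: gval x)// scalerA mulVf// scale1r.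
by rewrite normfV ler_pdivlMl// normr_gt0.
Qed.

Fact gspace_norm0_eq0 (x : gspace G) : gspace_norm x = 0 -> x = 0.
Proof.
move=> x0; apply/val_inj/funext => n; apply/eqP; rewrite -normr_le0.
by rewrite -x0; exact: coord_le_gnorm (gvalP x).
Qed.

HB.instance Definition _ := Lmodule_isNormed.Build R (gspace G)
  gspace_normD gspace_normZ gspace_norm0_eq0.

Lemma coord_le_norm (x : gspace G) n : `|gval x n| <= `|x|.
Proof. exact: coord_le_gnorm (gvalP x). Qed.

Lemma gvalB (x y : gspace G) n : gval (x - y) n = gval x n - gval y n.
Proof. by []. Qed.

Lemma gvalZ a (x : gspace G) n : gval (a *: x) n = a * gval x n.
Proof. by []. Qed.

Lemma gval_sum (I : Type) (r : seq I) (P : pred I) (f : I -> gspace G) n :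
  gval (\sum_(i <- r | P i) f i) n = \sum_(i <- r | P i) gval (f i) n.
Proof.
by elim/big_rec2 : _ => // i a b _ <-.
Qed.

(** A gauge involves finitely many coordinates, so pointwise convergence suffices; norm bounds
    therefore survive pointwise limits, which is what completeness needs. *)
Lemma qf_cvg (T : Type) (F : set_system T) (FF : Filter F) g
    (u : T -> nat -> R^o) (v : nat -> R^o) :
  (forall n, u t n @[t --> F] --> v n) -> qf g (u t) @[t --> F] --> qf g v.
Proof.
move=> uv; apply: cvg_big => //; first exact: add_continuous.
move=> c _; apply: cvgM; first exact: cvg_cst.
have rv : rowsum (u t) c.2 @[t --> F] --> rowsum v c.2.
  apply: cvg_big => //; first exact: add_continuous.
  by move=> n _; exact: cvg_norm.
by rewrite expr2; apply: cvgM.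
Qed.

Lemma gspace_complete (F : set_system (gspace G)) :
  ProperFilter F -> cauchy F -> cvg F.
Proof.
move=> FF /cauchy_ballP cF.
have cF' e : 0 < e -> exists2 A : set (gspace G), F A &
    forall x y, A x -> A y -> `|x - y| < e.
  move=> e0; have [[A B] [/= FA FB] AB] := cF e e0.
  exists (A `&` B); first exact: filterI.
  move=> x y [Ax _] [_ By]; have := AB (x, y) (conj Ax By).
  by rewrite -ball_normE.
have cvn n : cvg (gval x n @[x --> F]).
  apply: R_complete; apply/cauchy_ballP => e e0.
  have [A FA Ae] := cF' e e0.
  exists ((fun x : gspace G => gval x n) @` A, (fun x : gspace G => gval x n) @` A).

    by split; apply: (@filterS _ F _ A) => // x Ax; exists x.
  move=> [_ _] /= [[x Ax <-] [y Ay <-]].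
  by rewrite /ball/= -gvalB (le_lt_trans (coord_le_norm _ _))// Ae.
(* The limit is taken coordinatewise. It is known to lie in the space only after [key] bounds y - l
   for some y in the space. *)
pose l : nat -> R^o := fun n => lim (gval x n @[x --> F]).
have Fl n : gval x n @[x --> F] --> l n by exact: cvn.
have key e A y : 0 < e -> F A -> (forall x y, A x -> A y -> `|x - y| < e) ->
    A y -> gval y - l \in gbounded G /\ gnorm G (gval y - l) <= e.
  move=> e0 FA Ae Ay; apply/gnormP; first exact: ltW.
  move=> g Gg; apply: (@cvgr_to_le _ F _ _ (fun x => qf g (gval y - gval x))).
    by apply: qf_cvg => n; apply: cvgB; [exact: cvg_cst | exact: Fl].
  apply: filterS FA => x Ax.
  apply: le_trans (qf_gnorm Gg (gvalP (y - x))) _.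
  by rewrite lerXn2r ?nnegrE ?gnorm_ge0 ?ltW//; exact: Ae.
have bl : l \in gbounded G.
  have [A FA Ae] := cF' 1 ltr01.
  have [y Ay] := filter_ex FA.
  have [b _] := key _ _ _ ltr01 FA Ae Ay.
  rewrite (_ : l = gval y - (gval y - l)); last by rewrite opprB addrC subrK.
  by apply: rpredB => //; exact: gvalP.
apply/cvg_ex; exists (GSpace bl); apply/cvgrPdist_le => e e0.
have [A FA Ae] := cF' e e0.
apply: (filterS _ FA) => x Ax; rewrite distrC.
exact: (key _ _ _ e0 FA Ae Ax).2.
Qed.

HB.instance Definition _ := Uniform_isComplete.Build (gspace G) gspace_complete.

End GspaceNormed.

(** * Basis and upper estimates *)

Definition cut (R : realType) (P : pred nat) (x : nat -> R^o) : nat -> R^o :=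
  fun n => if P n then x n else 0.

(** Since x ranges over all sequences with bounded gauges, this is bounded completeness: every
    formal series with bounded norm converges. The bound is uniform in g, hence a bound on the norm
    of the tail. *)
Definition tails_vanish (R : realType) (G : gfam R) : Prop :=
  forall (x : nat -> R^o) (e : R), x \in gbounded G -> 0 < e ->
    exists N, forall g, G g -> qf g (cut (leq N) x) <= e.

(** The upper 2-estimate in squared form. A division into successive intervals is encoded by the
    monotone map [blk] sending a coordinate to the number of its interval. *)
Definition upper2 (R : realType) (G : gfam R) (K : R) : Prop :=
  forall (blk : nat -> nat) (n : nat) (x : nat -> R^o) (c : R),
    {homo blk : i j / (i <= j)%N} -> (forall t, x t != 0 -> (blk t < n)%N) ->
    (forall j g, (j < n)%N -> G g -> qf g (cut (fun t => blk t == j) x) <= c) ->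
    forall g, G g -> qf g x <= K * n%:R * c.

Section Basis.
Variables (R : realType) (G : gfam R).
Implicit Types (x y : gspace G).

Lemma cut_le (P : pred nat) (x : nat -> R^o) t : `|cut P x t| <= `|x t|.
Proof. by rewrite /cut; case: ifP; rewrite ?normr0. Qed.

Definition gcut (P : pred nat) x : gspace G :=
  GSpace (gnorm_sub (gvalP x) (cut_le P (gval x))).1.

Lemma gcutE P x t : gval (gcut P x) t = if P t then gval x t else 0.
Proof. by []. Qed.

Lemma gspaceP x y : (forall t, gval x t = gval y t) -> x = y.
Proof. by move=> xy; apply/val_inj/funext. Qed.

Lemma le_gspace_norm x y : (forall t, `|gval x t| <= `|gval y t|) -> `|x| <= `|y|.
Proof. by move=> /(gnorm_sub (gvalP y))[]. Qed.

Lemma gcut_norm P x : `|gcut P x| <= `|x|.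
Proof. by apply: le_gspace_norm => t; exact: cut_le. Qed.

Lemma gcutC P x : x - gcut P x = gcut (predC P) x.
Proof.
apply: gspaceP => t; rewrite gvalB !gcutE/=.
by case: (P t) => /=; rewrite ?subrr ?subr0.
Qed.

Lemma delta_bounded n : delta_seq R n \in gbounded G.
Proof.
apply/gboundedP; exists 1; first exact: ler01.
move=> g Gg; by rewrite expr1n; exact: (gset_unit n Gg).
Qed.

Definition gbasis n : gspace G := GSpace (delta_bounded n).

Lemma gbasisE n t : gval (gbasis n) t = (t == n)%:R.
Proof. by []. Qed.

Lemma gcut_sum n x : gcut (fun t => (t < n)%N) x =
  \sum_(0 <= i < n) gval x i *: gbasis i.
Proof.
apply: gspaceP => t; rewrite gcutE gval_sum.
under eq_bigr do rewrite gvalZ gbasisE.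
rewrite big_mkord; case: ifPn => [tn|tn].
  rewrite (bigD1 (Ordinal tn))//= eqxx mulr1 big1 ?addr0// => i it.
  rewrite [t == i](_ : _ = false) ?mulr0//.
  by apply: contraNF it => /eqP ti; apply/eqP/val_inj.
rewrite big1// => i _; rewrite [t == i](_ : _ = false) ?mulr0//.
by apply: contraNF tn => /eqP ->.
Qed.

Lemma series_gbasis (a : nat -> R) n t : (t < n)%N ->
  gval (series (fun i => a i *: gbasis i) n) t = a t.
Proof.
move=> tn; rewrite /series/= gval_sum big_mkord.
under eq_bigr do rewrite gvalZ gbasisE.
rewrite (bigD1 (Ordinal tn))//= eqxx mulr1 big1 ?addr0// => i it.
rewrite [t == i](_ : _ = false) ?mulr0//.
by apply: contraNF it => /eqP ti; apply/eqP/val_inj.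
Qed.

Lemma expansion_coord x a : expansion gbasis x a -> a = gval x.
Proof.
move=> ax; apply/funext => t; apply/eqP; rewrite eq_sym -subr_eq0 -normr_le0.
apply/ler_addgt0Pl => e e0; rewrite addr0.
have /cvgrPdist_le/(_ e e0)[N _ NP] := ax.
have Nt : (N <= maxn N t.+1)%N by exact: leq_maxl.
apply: le_trans (NP _ Nt); rewrite -(@series_gbasis a (maxn N t.+1) t) ?leq_maxr//.
by rewrite -gvalB; exact: coord_le_norm.
Qed.

Hypothesis tailsG : tails_vanish G.

Lemma gcut_tail x e : 0 < e -> exists N, forall P : pred nat,
  (forall t, (t < N)%N -> ~~ P t) -> `|gcut P x| <= e.
Proof.
move=> e0; have e20 : 0 < e ^+ 2 by rewrite exprn_gt0.
have [N NP] := tailsG (gvalP x) e20; exists N => P PN.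
have : `|gcut (leq N) x| <= e by apply: gnorm_le => //; exact: ltW.
apply: le_trans; apply: le_gspace_norm => t; rewrite !gcutE.
by case: ifPn => [Pt|]; rewrite ?normr0// leqNgt; case: ltnP => // /PN; rewrite Pt.
Qed.

Lemma gbasis_expansion x : expansion gbasis x (gval x).
Proof.
apply/cvgrPdist_le => e e0; have [N NP] := gcut_tail x e0.
exists N => // n /= Nn; rewrite /series/= -gcut_sum gcutC; apply: NP => t tN /=.
by rewrite negbK (leq_trans tN).
Qed.

Lemma gbasis_unconditional : unconditional_basis gbasis.
Proof.
split.
  move=> x; exists (gval x); split; first exact: gbasis_expansion.
  by move=> a /expansion_coord.
move=> x _ /expansion_coord -> s [r sK rK].
apply/cvgrPdist_le => e e0; have [N NP] := gcut_tail x e0.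
(* As r inverts s, from this point on the rearranged partial sum contains every index below N, and
   the remainder is a cut supported beyond N. *)
exists (\max_(i < N) r i).+1 => // n /= rn.
rewrite (_ : series _ n = gcut (fun t => (r t < n)%N) x).
  rewrite gcutC; apply: NP => t tN /=; rewrite negbK (leq_trans _ rn)// ltnS.
  exact: (leq_bigmax (Ordinal tN)).
apply: gspaceP => t; rewrite gcutE /series/= gval_sum big_mkord.
under eq_bigr do rewrite gvalZ gbasisE.
case: ifPn => [tn|tn].
  rewrite (bigD1 (Ordinal tn))//= rK eqxx mulr1.
  rewrite big1 ?addr0// => i it.
  rewrite [t == s i](_ : _ = false) ?mulr0//.
  by apply: contraNF it => /eqP ti; apply/eqP/val_inj; rewrite /= ti sK.
rewrite big1// => i _; rewrite [t == s i](_ : _ = false) ?mulr0//.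
by apply: contraNF tn => /eqP ->; rewrite sK.
Qed.

Lemma gbasis_supp x : supp gbasis x = [set n | gval x n != 0].
Proof.
apply/seteqP; split=> n /=; first by move=> [a /expansion_coord ->].
by move=> xn; exists (gval x) => //; exact: gbasis_expansion.
Qed.

Variable K : R.
Hypothesis K0 : 0 <= K.
Hypothesis upperG : upper2 G K.

Lemma block_sum_norm n (u : nat -> gspace G) (M : R) : 0 <= M ->
  (forall i j s t, (i < j)%N -> (j < n)%N ->
    gval (u i) s != 0 -> gval (u j) t != 0 -> (s < t)%N) ->
  (forall j, (j < n)%N -> `|u j| <= M) ->
  `|\sum_(j < n) u j| <= Num.sqrt (K * n%:R) * M.
Proof.
move=> M0 ord uM.
(* [blk t] is the last j whose vector has a nonzero coordinate at or before t: this is monotone in t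
   and equals j on the support of [u j]. *)
pose meets (j t : nat) := [exists s : 'I_t.+1, gval (u j) s != 0].
pose blk t := \max_(j < n | meets j t) nat_of_ord j.
have blk_eq j t : (j < n)%N -> gval (u j) t != 0 -> blk t = j.
  move=> jn ut; apply/eqP; rewrite eqn_leq; apply/andP; split.
    apply/bigmax_leqP => i /existsP[s us]; rewrite leqNgt; apply/negP => ji.
    have := ord _ _ _ _ ji (ltn_ord i) ut us.
    by rewrite ltnNge -ltnS ltn_ord.
  apply: (@leq_bigmax_cond _ _ _ (Ordinal jn)).
  by apply/existsP; exists ord_max.
have sum0 t : (forall j, (j < n)%N -> gval (u j) t = 0) ->
    gval (\sum_(j < n) u j) t = 0.
  by move=> ut; rewrite gval_sum big1// => i _; exact: ut.
apply: gnorm_le; first by rewrite mulr_ge0// sqrtr_ge0.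
move=> g Gg; rewrite exprMn sqr_sqrtr ?mulr_ge0//.
apply: (upperG (blk := blk)) => //.
- move=> s t st; apply/bigmax_leqP => i /existsP[r ur].
  apply: (@leq_bigmax_cond _ _ _ i).
  have rt : (r < t.+1)%N by rewrite ltnS (leq_trans _ st)// -ltnS.
  by apply/existsP; exists (Ordinal rt).
- move=> t nz; have [j jn jt] : exists2 j, (j < n)%N & gval (u j) t != 0.
    apply: contrapT => H; move/eqP: nz; apply; apply: sum0 => j jn.
    by apply/eqP; apply: contrapT => /negP nj; apply: H; exists j.
  by rewrite (blk_eq _ _ jn jt).
- move=> j h jn Gh; apply: le_trans (_ : qf h (gval (u j)) <= _).
    apply: ler_qf; first exact: gset_nonneg Gh.
    move=> t; rewrite /cut; case: ifPn => [/eqP tj|]; last by rewrite normr0.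
    rewrite gval_sum (bigD1 (Ordinal jn))//= big1 ?addr0// => i ij.
    apply/eqP; apply: contraNT ij => /(blk_eq _ _ (ltn_ord i)) ti.
    by apply/eqP/val_inj; rewrite /= -ti tj.
  apply: le_trans (qf_gnorm Gh (gvalP (u j))) _.
  by rewrite lerXn2r ?nnegrE ?gnorm_ge0//; exact: uM.
Qed.

Lemma dual0 (f : gspace G -> R^o) : linear f -> f 0 = 0.
Proof.
by move=> lf; have := lf (-1) 0 0; rewrite scaler0 addr0 scaleN1r addNr.
Qed.

Lemma dualZ (f : gspace G -> R^o) a x : linear f -> f (a *: x) = a * f x.
Proof. by move=> lf; have := lf a x 0; rewrite !addr0 (dual0 lf) addr0. Qed.

Lemma dual_bound (f : gspace G -> R^o) : dual f ->
  exists2 C : R, 0 < C & forall x, `|f x| <= C * `|x|.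
Proof.
move=> [lf cf].
have /cvgrPdist_le/(_ 1 ltr01) := cf 0; rewrite (dual0 lf).
move=> /nbhs_ballP[d /= d0 dP].
exists (2 / d); first by rewrite divr_gt0.
move=> x; have [->|x0] := eqVneq x 0; first by rewrite (dual0 lf) !normr0 mulr0.
have nx : 0 < `|x| by rewrite normr_gt0.
have : `|f ((d / 2 / `|x|) *: x)| <= 1.
  have := dP ((d / 2 / `|x|) *: x); rewrite /= sub0r normrN; apply.
  rewrite -ball_normE/= sub0r normrN normrZ ger0_norm.
    by rewrite divfK ?gt_eqF// gtr_pMr// invf_lt1// ltr1n.
  by rewrite !divr_ge0// ltW.
rewrite (dualZ _ _ lf) normrM ger0_norm; last by rewrite !divr_ge0// ltW.
rewrite -ler_pdivlMl; last by rewrite !divr_gt0.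
by move=> /le_trans; apply; rewrite mulr1 !invfM !invrK mulrC [d^-1 * 2]mulrC mulrC.
Qed.

End Basis.

(** * Reflexivity *)

Section Reflexivity.
Variables (R : realType) (G : gfam R).
Implicit Types (x y : gspace G).
Hypothesis tailsG : tails_vanish G.
Variable K : R.
Hypothesis K0 : 0 <= K.
Hypothesis upperG : upper2 G K.

Lemma dualD (f : gspace G -> R^o) x y : linear f -> f (x + y) = f x + f y.
Proof. by move=> lf; have := lf 1 x y; rewrite !scale1r. Qed.

Lemma dualB (f : gspace G -> R^o) x y : linear f -> f (x - y) = f x - f y.
Proof.
by move=> lf; rewrite dualD// -scaleN1r dualZ// mulN1r.
Qed.

Lemma dual_sum (f : gspace G -> R^o) n (u : nat -> gspace G) : linear f ->
  f (\sum_(i < n) u i) = \sum_(i < n) f (u i).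
Proof.
move=> lf; elim: n => [|n IH]; last by rewrite !big_ord_recr/= dualD// IH.
by rewrite !big_ord0 (dual0 lf).
Qed.

Lemma bounded_dual (f : gspace G -> R^o) (C : R) : linear f ->
  (forall x, `|f x| <= C * `|x|) -> dual f.
Proof.
move=> lf fC; split; first exact: lf.
move=> x; apply/(@cvgrPdist_le _ _ _ _ (nbhs_filter x)) => e e0.
have C1 : 0 < `|C| + 1 by rewrite ltr_pwDr.
apply/nbhs_ballP; exists (e / (`|C| + 1)); first by rewrite /= divr_gt0.
move=> y /=; rewrite -ball_normE/= => xy.
rewrite -dualB// (le_trans (fC _))//.
rewrite (@le_trans _ _ ((`|C| + 1) * `|x - y|))//.
  by rewrite ler_wpM2r// (le_trans (ler_norm _))// lerDl.
by rewrite -ler_pdivlMl// mulrC ltW.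
Qed.

Lemma dual_norm_le (f : gspace G -> R^o) (C : R) : 0 <= C ->
  (forall x, `|f x| <= C * `|x|) -> dual_norm f <= C.
Proof.
move=> C0 fC; apply: ge_sup; first by exists `|f 0|, 0; rewrite //= normr0.
move=> _ [x /= x1 <-]; rewrite (le_trans (fC _))//.
by rewrite -[leRHS]mulr1 ler_wpM2l.
Qed.

Lemma dual_norm_ge0 (f : gspace G -> R^o) : dual f -> 0 <= dual_norm f.
Proof.
move=> /dual_bound[C C0 fC]; apply: le_trans (normr_ge0 (f 0)) _.
apply: sup_upper_bound; last by exists 0; rewrite //= normr0.
split; first by exists `|f 0|, 0; rewrite //= normr0.
exists C => _ [x /= x1 <-]; rewrite (le_trans (fC _))//.
by rewrite -[leRHS]mulr1 ler_wpM2l// ltW.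
Qed.

(** The basis is shrinking. Otherwise a gliding hump yields successive finitely supported vectors of
    the unit ball on which f is at least e; f is then at least n e on the sum of n of them, whose
    norm is at most the root of K n. *)
Lemma dual_tail (f : gspace G -> R^o) e : dual f -> 0 < e ->
  exists N, forall x, (forall t, (t < N)%N -> gval x t = 0) ->
    `|f x| <= e * `|x|.
Proof.
move=> df e0; have [lf _] := df; have [C C0 fC] := dual_bound df.
apply: contrapT => /forallNP noN.
have pick N : exists yM : gspace G * nat,
    [/\ forall t, (t < N)%N || (yM.2 <= t)%N -> gval yM.1 t = 0,
        `|yM.1| <= 1 & e <= f yM.1].
  have /existsNP[x /not_implyP[xN /negP]] := noN N; rewrite -ltNge => xe.
  (* Truncating x with error d changes f by at most half of the excess of |f x| over e |x|, so the
     truncation still violates the bound. *)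
  pose d := (`|f x| - e * `|x|) / 2 / C.
  have d0 : 0 < d by rewrite !divr_gt0// subr_gt0.
  have [M MP] := gcut_tail tailsG x d0.
  pose z := gcut (fun t => (t < M)%N) x.
  have fz : e * `|z| < `|f z|.
    have fx : f x = f z + f (x - z) by rewrite -dualD// addrC subrK.
    have fxz : `|f (x - z)| <= (`|f x| - e * `|x|) / 2.
      rewrite (le_trans (fC _))// mulrC -ler_pdivlMr// gcutC.
      by apply: MP => t tM /=; rewrite tM.
    have ez : e * `|z| <= e * `|x| by rewrite ler_wpM2l ?gcut_norm// ltW.
    have := ler_normD (f z) (f (x - z)); rewrite -fx; lra.
  have z0 : 0 < `|z|.
    rewrite normr_gt0; apply: contraTneq fz => ->.
    by rewrite (dual0 lf) !normr0 mulr0 ltxx.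
  have yN t : (t < N)%N || (M <= t)%N -> gval ((Num.sg (f z) / `|z|) *: z) t = 0.
    rewrite gvalZ gcutE => /orP[tN|tM]; first by rewrite xN// if_same mulr0.
    by rewrite ltnNge tM mulr0.
  have y1 : `|(Num.sg (f z) / `|z|) *: z| <= 1.
    rewrite normrZ normrM normfV normr_id divfK ?gt_eqF//.
    by rewrite normr_sg; case: eqP.
  have fy : e <= f ((Num.sg (f z) / `|z|) *: z).
    by rewrite dualZ// mulrAC -normrEsg ler_pdivlMr//; exact: ltW.
  by exists ((Num.sg (f z) / `|z|) *: z, M).
have [yM yMP] := choice pick.
(* Each hump is picked beyond the end of the previous one, recorded in the second component of
   [yM]. *)
pose N := fix N i := if i is j.+1 then maxn (N j) (yM (N j)).2 else 0%N.
pose u i := (yM (N i)).1.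
have Nmono i j : (i <= j)%N -> (N i <= N j)%N.
  by elim: j => [|j IH]; rewrite leq_eqVlt => /predU1P[->//|//]; rewrite ltnS =>
    /IH /leq_trans; apply; exact: leq_maxl.
have uN i t : gval (u i) t != 0 -> (N i <= t < N i.+1)%N.
  have [uz _ _] := yMP (N i); move=> ut; rewrite leqNgt; apply/andP; split.
    by apply: contraNN ut => tN; rewrite uz// tN.
  rewrite ltnNge; apply: contraNN ut => /= tN.
  by rewrite uz// (leq_trans (leq_maxr _ _) tN) orbT.
have sum_le n : n%:R * e ^+ 2 <= C ^+ 2 * K.
  have ns : `|\sum_(j < n) u j| <= Num.sqrt (K * n%:R) * 1.
    apply: (block_sum_norm K0 upperG) => // [i j s t ij jn /uN /andP[_ si] /uN/andP[tj _]|j jn].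
      by apply: leq_trans si (leq_trans (Nmono _ _ ij) tj).
    by have [] := yMP (N j).
  have fs : n%:R * e <= f (\sum_(j < n) u j).
    rewrite (dual_sum _ _ lf) (_ : n%:R * e = \sum_(i < n) e); last first.
      by rewrite sumr_const card_ord mulr_natl.
    by apply: ler_sum => i _; have [] := yMP (N i).
  have H : n%:R * e <= C * Num.sqrt (K * n%:R).
    rewrite (le_trans fs)// (le_trans (ler_norm _))// (le_trans (fC _))//.
    by apply: ler_wpM2l; [exact: ltW | move: ns; rewrite mulr1].
  have [->|n0] := posnP n; first by rewrite mul0r mulr_ge0// sqr_ge0.
  have : (n%:R * e) ^+ 2 <= (C * Num.sqrt (K * n%:R)) ^+ 2.
    by rewrite lerXn2r ?nnegrE ?mulr_ge0 ?sqrtr_ge0// ltW.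
  rewrite exprMn [X in _ <= X -> _]exprMn sqr_sqrtr ?mulr_ge0// => H2.
  have n0R : (0 : R) < n%:R by rewrite ltr0n.
  by rewrite -(ler_pM2r n0R); lra.
have e20 : 0 < e ^+ 2 by rewrite exprn_gt0.
have CK : 0 <= C ^+ 2 * K / e ^+ 2 by rewrite divr_ge0 ?sqr_ge0// mulr_ge0 ?sqr_ge0.
have := sum_le (Num.truncn (C ^+ 2 * K / e ^+ 2)).+1.
rewrite -ler_pdivlMr// leNgt => /negP; apply.
by rewrite truncnS_gt.
Qed.

Lemma coord_dual n : dual (fun x => gval x n : R^o).
Proof.
by apply: (@bounded_dual _ 1) => [a x y|x]; rewrite ?mul1r ?coord_le_norm.
Qed.

Lemma dual_lin (a : R) (f h : gspace G -> R^o) : dual f -> dual h ->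
  dual (a *: f + h : gspace G -> R^o).
Proof.
move=> df dh; have [lf _] := df; have [lh _] := dh.
have [C C0 fC] := dual_bound df; have [D D0 hD] := dual_bound dh.
apply: (@bounded_dual _ (`|a| * C + D)) => [b x y|x].
  change (a * f (b *: x + y) + h (b *: x + y) =
    b * (a * f x + h x) + (a * f y + h y) :> R).
  by rewrite !dualD// !dualZ//; ring.
rewrite (le_trans (ler_normD _ _))// mulrDl lerD//.
by rewrite normrM -mulrA ler_wpM2l.
Qed.

(** * Representing a bounded functional on the dual by a vector *)

Section Bidual.
Variable phi : (gspace G -> R^o) -> R.
Hypothesis phi_lin : forall a f h, dual f -> dual h ->
  phi (a *: f + h) = a * phi f + phi h.
Variable C : R.
Hypothesis phi_bounded : forall f, dual f -> `|phi f| <= C * dual_norm f.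

Lemma dual_zero : dual (0 : gspace G -> R^o).
Proof.
by apply: (@bounded_dual _ 0) => [a x y|x]; rewrite ?scaler0 ?addr0// normr0 mul0r.
Qed.

Lemma phi_zero : phi 0 = 0.
Proof.
have := phi_lin (-1) dual_zero dual_zero.
by rewrite scaler0 addr0 mulN1r addNr.
Qed.

Lemma phi_sum (I : Type) (s : seq I) (a : I -> R) (f : I -> gspace G -> R^o) :
  (forall i, dual (f i)) ->
  dual (\sum_(i <- s) a i *: f i) /\
  phi (\sum_(i <- s) a i *: f i) = \sum_(i <- s) a i * phi (f i).
Proof.
move=> df; elim: s => [|i s [IH1 IH2]].
  by rewrite !big_nil phi_zero; split=> //; exact: dual_zero.
by rewrite !big_cons phi_lin// IH2; split=> //; exact: dual_lin.
Qed.

Lemma phi_le f c : dual f -> 0 <= c -> (forall x, `|f x| <= c * `|x|) ->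
  `|phi f| <= `|C| * c.
Proof.
move=> df c0 fc; apply: (le_trans (phi_bounded df)).
apply: (@le_trans _ _ (`|C| * dual_norm f)).
  by rewrite ler_wpM2r ?dual_norm_ge0// ler_norm.
by rewrite ler_wpM2l// dual_norm_le.
Qed.

Let x0 : nat -> R^o := fun n => phi (fun x => gval x n).

(** For each gauge g, the functional f attached to [x0] by the bilinear form of g, with the signs of
    [x0] inside rows, satisfies [phi f = qf g x0]. By Cauchy-Schwarz its norm is at most the root of
    [qf g x0], and dividing by that root bounds it by |C|. *)
Lemma bidual_coord_bounded : x0 \in gbounded G.
Proof.
apply/gboundedP; exists `|C| => // g Gg; have g0 := gset_nonneg Gg.
pose coordf n := (fun x : gspace G => gval x n : R^o).
pose h c := \sum_(t <- c) Num.sg (x0 t) *: coordf t.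
have dh c : dual (h c) by apply: (phi_sum c _ coord_dual).1.
have ph c : phi (h c) = rowsum x0 c.
  rewrite (phi_sum c _ coord_dual).2; apply: eq_bigr => t _.
  by rewrite -normrEsg.
pose f := \sum_(c <- g) (c.1 * rowsum x0 c.2) *: h c.2.
have [df pf] := phi_sum g (fun c => c.1 * rowsum x0 c.2) (fun c => dh c.2).
have pfE : phi f = qf g x0.
  by rewrite pf; apply: eq_bigr => c _; rewrite ph -mulrA.
have hx c x : `|h c x| <= rowsum (gval x) c.
  rewrite /h fct_sumE (le_trans (ler_norm_sum _ _ _))// ler_sum// => t _.
  rewrite normrM normr_sg; case: eqP => _; rewrite ?mul1r ?mul0r//.
have fx x : `|f x| <= Num.sqrt (qf g x0) * `|x|.
  rewrite /f fct_sumE (le_trans (ler_norm_sum _ _ _))//.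
  apply: (@le_trans _ _ (\sum_(c <- g) c.1 * rowsum x0 c.2 * rowsum (gval x) c.2)).
    rewrite !big_seq ler_sum// => c /g0 c0.
    by rewrite normrM ger0_norm ?mulr_ge0 ?rowsum_ge0// ler_wpM2l ?mulr_ge0 ?rowsum_ge0.
  rewrite (le_trans (qf_cauchy_schwarz _ _ g0))// ler_wpM2l ?sqrtr_ge0//.
  exact: sqrt_qf_gnorm (gvalP x).
have := phi_le df (sqrtr_ge0 _) fx; rewrite pfE ger0_norm ?qf_ge0//.
have [->|q0] := eqVneq (qf g x0) 0; first by rewrite sqr_ge0.
have sq0 : 0 < Num.sqrt (qf g x0) by rewrite sqrtr_gt0 lt_def q0 qf_ge0.
rewrite -{1}(sqr_sqrtr (qf_ge0 x0 g0)) expr2 ler_pM2r// => qC.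
by rewrite -(sqr_sqrtr (qf_ge0 x0 g0)) lerXn2r ?nnegrE// ltW.
Qed.

(** [phi] and evaluation at [xx] agree on coordinate functionals, hence on the truncations [fN]; as
    the basis is shrinking, [fN] approximates f in the dual norm. *)
Lemma bidual_representation : exists x, forall f, dual f -> phi f = f x.
Proof.
exists (GSpace bidual_coord_bounded) => f df; set xx := GSpace _.
have [lf _] := df.
apply/eqP; rewrite -subr_eq0 -normr_le0; apply/ler_addgt0Pl => e e0; rewrite addr0.
(* The errors of [phi] and of evaluation at [xx] add up to at most (|C| + |xx|) e / M; the summand 1
   keeps M positive. *)
pose M := `|C| + `|xx| + 1.
have M0 : 0 < M by rewrite ltr_wpDl// addr_ge0.
have d0 : 0 < e / M by rewrite divr_gt0.
have [N NP] := dual_tail df d0.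
pose coordf n := (fun x : gspace G => gval x n : R^o).
pose fN := \sum_(0 <= n < N) f (gbasis G n) *: coordf n.
have [dfN pfN] := phi_sum (index_iota 0 N) (fun n => f (gbasis G n)) coord_dual.
have fNE x : fN x = f (gcut (fun t => (t < N)%N) x).
  rewrite gcut_sum !big_mkord /fN.
  rewrite (dual_sum N (fun i => gval x i *: gbasis G i) lf).
  rewrite /fN big_mkord fct_sumE; apply: eq_bigr => i _.
  by rewrite dualZ// mulrC.
have tail x : `|f x - fN x| <= e / M * `|x|.
  rewrite fNE -dualB// gcutC.
  apply: (le_trans (NP _ _)).
    by move=> t tN; rewrite gcutE /= tN.
  by rewrite ler_wpM2l ?gcut_norm// ltW.
have pE : phi fN = fN xx.
  rewrite pfN /fN fct_sumE; apply: eq_bigr => n _; by [].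
have dsub : dual (-1 *: fN + f) by exact: dual_lin.
have H1 : `|phi f - phi fN| <= `|C| * (e / M).
  rewrite (_ : phi f - phi fN = phi (-1 *: fN + f)); last first.
    by rewrite (phi_lin (-1) dfN df) mulN1r addrC.
  apply: phi_le => //; first exact: ltW.
  move=> x; apply: le_trans (tail x).
  change (`|-1 * fN x + f x| <= `|f x - fN x|).
  by rewrite mulN1r addrC.
have H2 := tail xx.
have -> : phi f - f xx = (phi f - phi fN) - (f xx - fN xx).
  by rewrite pE opprB addrA subrK.
apply: (le_trans (ler_normB _ _)).
apply: (@le_trans _ _ (e / M * (`|C| + `|xx|))).
  by rewrite mulrDr lerD// mulrC.
by rewrite mulrAC ler_pdivrMr// ler_wpM2l ?ltW// /M ltrDl.
Qed.

End Bidual.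

Lemma gspace_reflexive : reflexive_space (gspace G).
Proof.
move=> phi phi_lin [C phi_bounded].
exact (bidual_representation phi_lin phi_bounded).
Qed.

End Reflexivity.

(** * Plegma tuples in regular thin families *)

(** Fixing the first n coordinates gives a neighbourhood base of the product topology, so closedness
    is tested on initial segments. *)
Lemma closed_cantorP (A : set cantor_space) :
  closed A <-> forall c : nat -> bool,
    (forall n, exists2 d : nat -> bool, A d & forall i, (i < n)%N -> d i = c i) ->
    A c.
Proof.
split=> [clA c Ac|H c cA].
  have /choice[d dP] n : exists d : nat -> bool,
      A d /\ forall i, (i < n)%N -> d i = c i.
    by have [d Ad dc] := Ac n; exists d.
  have dcvg : (d : nat -> cantor_space) @ \oo --> (c : cantor_space).
    apply/cvg_sup => N U [V] [[W] oW <-] WfN WU.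
    apply: (filterS WU); rewrite nbhs_simpl; exists N.+1 => // i /= Ni.
    by move: WfN; rewrite /= /proj (dP i).2.
  by apply: (closed_cvg (fun d => A d) clA _ c dcvg); apply: nearW => n; exact: (dP n).1.
apply: H => n.
have FF : Filter (nbhs (c : cantor_space)) by exact: nbhs_filter.
have : nbhs (c : cantor_space) [set d : cantor_space | forall i, (i < n)%N -> d i = c i].
  elim: n => [|n IH]; first by apply: (@filterS _ _ FF setT _ _ (@filterT _ _ FF)).
  have Hn : nbhs c (proj n @^-1` [set c n]).
    apply: (@proj_continuous _ (fun=> bool : topologicalType) n c).
    exact: discrete_set1.
  apply: (@filterS2 _ _ FF _ _ _ _ IH Hn) => d dn; rewrite /proj/= => dcn i.
  by rewrite ltnS leq_eqVlt => /predU1P[->|/dn].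
by move=> /cA[d [Ad dc]]; exists d.
Qed.

Section FiniteSets.
Implicit Types (s t : {fset nat}) (l : seq nat).

Lemma mem_elems s x : (x \in elems s) = (x \in s).
Proof. by rewrite mem_sort. Qed.

Lemma elems_sorted s : sorted ltn (elems s).
Proof.
by rewrite ltn_sorted_uniq_leq sort_uniq fset_uniq/= sort_sorted//; exact: leq_total.
Qed.

Lemma size_elems s : size (elems s) = #|` s|.
Proof. by rewrite size_sort. Qed.

Lemma sorted_ltn_ext l l' : sorted ltn l -> sorted ltn l' -> l =i l' -> l = l'.
Proof.
by move=> sl sl' ll'; apply: (irr_sorted_eq ltn_trans ltnn).
Qed.

Lemma elems_seq l : sorted ltn l -> elems [fset x in l]%fset = l.
Proof.
move=> sl; apply: sorted_ltn_ext => //; first exact: elems_sorted.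
by move=> x; rewrite mem_elems !inE.
Qed.

Lemma elems_inj : injective elems.
Proof.
by move=> s t st; apply/fsetP => x; rewrite -mem_elems st mem_elems.
Qed.

Lemma elems0 : elems fset0 = [::].
Proof. by apply: size0nil; rewrite size_elems cardfs0. Qed.

Lemma elemsU1 t q : (forall x, x \in t -> (x < q)%N) ->
  elems (q |` t)%fset = rcons (elems t) q.
Proof.
move=> tq; apply: sorted_ltn_ext; first exact: elems_sorted.
  have := elems_sorted t; have : all (ltn^~ q) (elems t).
    by apply/allP => x; rewrite mem_elems => /tq.
  case: (elems t) => //= a l /andP[aq lq] al.
  rewrite rcons_path al /=; have := mem_last a l.
  by rewrite inE => /predU1P[->//|/(allP lq)].
by move=> x; rewrite mem_elems mem_rcons !inE mem_elems.
Qed.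

Lemma elem_mem s k : (k < #|` s|)%N -> elem s k \in s.
Proof. by rewrite -size_elems -mem_elems => ks; exact: mem_nth. Qed.

Lemma elem_ltn s i j : (i < j)%N -> (j < #|` s|)%N -> (elem s i < elem s j)%N.
Proof.
move=> ij js; have si : (i < #|` s|)%N by exact: ltn_trans js.
have := elems_sorted s => /(sorted_ltn_nth ltn_trans 0%N); apply => //.
  by rewrite inE size_elems.
by rewrite inE size_elems.
Qed.

End FiniteSets.

(** * Existence of plegma tuples far out in a regular thin family *)

Section PlegmaExistence.
Variable F : set {fset nat}.
Hypothesis rF : regular_thin F.

(** A member of F properly extending t has a next element p after t; spreading allows p to be
    replaced by any larger q. *)
Lemma hat_extension t : hat F t -> ~ F t -> exists p, forall q, (p <= q)%N ->
  (forall x, x \in t -> (x < q)%N) /\ hat F (q |` t)%fset.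
Proof.
have [_ [_ spr _]] := rF.
move=> [s Fs ts] nFt; have /prefixP[[|p r] sE] := ts.
  have st : s = t by apply: elems_inj; rewrite sE cats0.
  by move: nFt; rewrite -st.
have := elems_sorted s; rewrite sE -cat_rcons => srt.
have srtp : sorted ltn (rcons (elems t) p) := (cat_sorted2 srt).1.
have tp x : x \in t -> (x < p)%N.
  rewrite -mem_elems => xt; have := srtp; rewrite -cats1.
  rewrite (sorted_pairwise ltn_trans) pairwise_cat => /and3P[/allrelP H _ _].
  by apply: H => //; rewrite mem_seq1.
exists p => q pq; have tq x : x \in t -> (x < q)%N by move=> /tp /leq_trans; apply.
split=> //; apply: (spr (p |` t)%fset).
- by exists s => //; rewrite /initial elemsU1// sE -cat_rcons prefix_prefix.
- by rewrite -!size_elems !elemsU1// !size_rcons.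
- move=> k _; rewrite /elem !elemsU1// !nth_rcons.
  by case: ltnP => // _; case: eqP.
Qed.

Definition range_seg (N : nat -> nat) n := [fset x in map N (iota 0 n)]%fset.

Lemma range_segP N n x :
  reflect (exists2 i, (i < n)%N & x = N i) (x \in range_seg N n).
Proof.
rewrite [X in reflect _ X](_ : _ = (x \in map N (iota 0 n))); last by rewrite !inE.
apply: (iffP mapP) => -[i]; first by rewrite mem_iota add0n => ? ->; exists i.
by move=> ni ->; exists i; rewrite // mem_iota add0n.
Qed.

Lemma elems_range_seg N n : {homo N : i j / (i < j)%N} ->
  elems (range_seg N n) = map N (iota 0 n).
Proof.
by move=> Nm; rewrite elems_seq//; apply: (homo_sorted Nm); exact: iota_ltn_sorted.
Qed.

Lemma range_segS N n : range_seg N n.+1 = (N n |` range_seg N n)%fset.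
Proof.
rewrite /range_seg -[n.+1]addn1 iotaD map_cat.
by apply/fsetP => x; rewrite !inE orbF add0n orbC.
Qed.

(** Every sufficiently sparse set has an initial segment in F: otherwise all its initial segments
    would stay in [hat F] without ending, against compactness. *)
Lemma initial_segment_in_family : hat F fset0 -> ~ F fset0 ->
  exists (p : nat) (q : nat -> nat), forall N : nat -> nat,
    {homo N : i j / (i < j)%N} -> (p <= N 0)%N ->
    (forall i, (q (N i) <= N i.+1)%N) ->
    exists2 n, (0 < n)%N & F (range_seg N n).
Proof.
move=> h0 nF0; have [_ [_ _ /closed_cantorP cF]] := rF.
have /choice[p pP] t : exists p, hat F t -> ~ F t -> forall q, (p <= q)%N ->
  (forall x, x \in t -> (x < q)%N) /\ hat F (q |` t)%fset.
  have [[ht nFt]|H] := pselect (hat F t /\ ~ F t).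
    by have [p pP] := hat_extension ht nFt; exists p.
  by exists 0%N => ht nFt; exfalso; apply: H.
(* [q v] dominates the extension thresholds of all subsets of {0, ..., v}, so one gap condition
   serves every initial segment ending at v. *)
pose q v := \max_(u <- fpowerset [fset x in iota 0 v.+1]%fset) p u.
exists (p fset0), q => N Nm Np Nq.
apply: contrapT => noF.
have seg0 : range_seg N 0 = fset0 by apply/fsetP => x; rewrite !inE.
have nFN n : ~ F (range_seg N n).
  case: n => [|n]; first by rewrite seg0.
  by move=> FN; apply: noF; exists n.+1.
have pN n : (p (range_seg N n) <= N n)%N.
  case: n => [|n]; first by rewrite seg0.
  apply: leq_trans (Nq n); rewrite /q.
  apply: (@leq_bigmax_seq _ _ _ (fun u => p u)) => //.
  rewrite fpowersetE; apply/fsubsetP => x /range_segP[i]; rewrite ltnS => iN ->.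
  rewrite !inE; change (N i \in iota 0 (N n).+1); rewrite mem_iota add0n ltnS/=.
  by move: iN; rewrite leq_eqVlt => /predU1P[->//|/Nm/ltnW].
have hN n : hat F (range_seg N n).
  elim: n => [|n IH]; first by rewrite seg0.
  by rewrite range_segS; exact: (pP _ IH (nFN n) _ (pN n)).2.
(* Compactness would identify the range of N with a finite set s, which cannot hold #|s| + 1
   distinct values. *)
have [|s hs sE] := cF (fun x => `[< range N x >]).
  move=> n; exists (char_fun (range_seg N n)); first by exists (range_seg N n).
  move=> x xn; rewrite /char_fun; apply/range_segP/asboolP.
    by move=> [i _ ->]; exists i.
  move=> [i _ Nx]; exists i => //.
  apply: leq_ltn_trans xn; rewrite -Nx.
  by elim: i {Nx} => // i IH; exact: leq_ltn_trans IH (Nm _ _ (ltnSn i)).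
have : {subset map N (iota 0 #|` s|.+1) <= elems s}.
  move=> _ /mapP[i _ ->]; rewrite mem_elems.
  by have := congr1 (@^~ (N i)) sE; rewrite /char_fun => ->; apply/asboolP; exists i.
have uN : uniq (map N (iota 0 #|` s|.+1)).
  rewrite map_inj_uniq ?iota_uniq// => i j Nij.
  by case: (ltngtP i j) => // /Nm; rewrite Nij ltnn.
by move=> /(uniq_leq_size uN); rewrite size_map size_iota size_elems ltnn.
Qed.

Lemma plegma_exists (m : nat -> nat) : {homo m : i j / (i < j)%N} ->
  (exists2 t, hat F t & t != fset0) -> forall k l,
  exists s : k.+1.-tuple {fset nat},
    [/\ forall j, restr F m (tnth s j), plegma s &
        (m l <= elem (tnth s ord0) 0)%N].
Proof.
move=> mm [t [s0 Fs0 ts0] t0] k l.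
have h0 : hat F fset0.
  by exists s0 => //; rewrite /initial elems0 prefix0s.
(* By thinness, the empty set in F would exclude every nonempty member. *)
have nF0 : ~ F fset0.
  move=> F0; have := rF.1 _ _ F0 Fs0; rewrite /proper_initial /initial elems0 prefix0s/=.
  rewrite negbK => /eqP s00; move: ts0 t0.
  by rewrite -s00 /initial elems0 prefixs0 -size_eq0 size_elems cardfs_eq0 => ->.
have [p [q pqP]] := initial_segment_in_family h0 nF0.
have m_ge i : (i <= m i)%N.
  by elim: i => // i IH; exact: leq_ltn_trans IH (mm _ _ (ltnSn i)).
(* M runs inside the range of m, starts beyond both m l and p, and grows fast enough for
   [initial_segment_in_family]. *)
pose M := fix M i := if i is j.+1 then m (maxn (M j).+1 (q (M j))) else m (maxn l p).
have MS i : (M i < M i.+1)%N by rewrite /= (leq_trans _ (m_ge _))// leq_maxl.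
have Mlt : {homo M : i j / (i < j)%N} by apply: homo_ltn => //; exact: ltn_trans.
have Mle i j : (i <= j)%N -> (M i <= M j)%N.
  by rewrite leq_eqVlt => /predU1P[->//|/Mlt/ltnW].
have Mm i : range m (M i) by case: i => [|i] /=; eexists.
(* The k + 1 sets are initial segments of the subsequences of M along the residue classes modulo k +
   1. These interlace, so the tuple is plegma whatever the lengths. *)
pose N (j : nat) i := M (j + k.+1 * i)%N.
have Nm j : {homo N j : i i' / (i < i')%N}.
  by move=> i i' ii'; apply: Mlt; rewrite ltn_add2l ltn_pmul2l.
have /choice[n nP] j : exists n, (0 < n)%N /\ F (range_seg (N j) n).
  have [||n n0 Fn] := pqP (N j) (Nm j); last by exists n.
    rewrite /N muln0 addn0 (leq_trans _ (Mle 0%N j (leq0n j)))//=.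
    by rewrite (leq_trans _ (m_ge _))// leq_maxr.
  move=> i; apply: (@leq_trans (M (j + k.+1 * i).+1)).
    by rewrite /= (leq_trans _ (m_ge _))// leq_maxr.
  by apply: Mle; rewrite mulnS addnCA addSn ltnS leq_addl.
exists [tuple of mkseq (fun j => range_seg (N j) (n j)) k.+1].
have tE j : tnth [tuple of mkseq (fun j => range_seg (N j) (n j)) k.+1] j =
    range_seg (N j) (n j).
  by rewrite (tnth_nth fset0) nth_mkseq.
have card j : #|` range_seg (N j) (n j)| = n j.
  by rewrite -size_elems elems_range_seg// size_map size_iota.
have elE (j : nat) i : (i < n j)%N -> elem (range_seg (N j) (n j)) i = N j i.
  by move=> ij; rewrite /elem elems_range_seg// (nth_map 0%N) ?size_iota// nth_iota.
split.
- move=> j; rewrite tE; split; first exact: (nP j).2.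
  by move=> i /range_segP[i' _ ->]; exact: Mm.
- split.
  + by move=> i; rewrite tE -cardfs_gt0 card (nP i).1.
  + move=> i j r ij; rewrite !tE !card leq_min => /andP[ri rj].
    by rewrite !elE//; apply: Mlt; rewrite ltn_add2r.
  + move=> i j r; rewrite !tE !card leq_min => /andP[ri rj].
    have rj' : (r.+1 < n j)%N by move: rj; have := (nP j).1; case: (n j).
    rewrite !elE//; apply: Mlt; rewrite mulnS addnA ltn_add2r.
    by rewrite (leq_trans (ltn_ord i))// leq_addl.
- rewrite tE elE ?(nP _).1// /N muln0 addn0 (leq_trans _ (Mle 0%N _ (leq0n _)))//=.
  by have := leq_maxl l p; rewrite leq_eqVlt => /predU1P[<-//|/mm/ltnW].
Qed.
End PlegmaExistence.

(** * Excluding plegma block generated l1 spreading models *)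

Lemma has_order_nonempty (F : set {fset nat}) (xi : cord) :
  has_order F xi -> ole (ofin 1) xi -> exists2 t, hat F t & t != fset0.
Proof.
move=> [h0 [rk rkF [_ xirk]]] xi1; apply: contrapT => none.
(* If the root were the only node, its rank would be the supremum of the empty set. *)
have rk0 : ole (rk fset0) OZero.
  apply: (rkF _ h0).2 => b [t [ht /andP[_ t0]] _].
  by exfalso; apply: none; exists t; rewrite // eq_sym.
move: xirk rk0 xi1; case: xi => [|f] /=; first by move=> _ _ /(_ 0%N).
by case: (rk fset0) => [|g] /=; [move=> /(_ 0%N) | move=> _ /(_ 0%N)].
Qed.

Lemma plegma1 (s : {fset nat}) : s != fset0 -> plegma [tuple s].
Proof.
move=> s0; split=> [i|i j n|i j n]; first by rewrite ord1.
  by rewrite !ord1 ltnn.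
rewrite !ord1 !tnth0 leq_min => /andP[_ ns]; apply: elem_ltn => //.
by move: ns; case: #|` s|.
Qed.

Lemma plegma_pair k (s : k.-tuple {fset nat}) (i j : 'I_k) : plegma s ->
  (i < j)%N -> plegma [tuple tnth s i; tnth s j].
Proof.
move=> [s0 ps1 ps2] ij.
pose u (a : 'I_2) : 'I_k := if a == ord0 then i else j.
have uE a : tnth [tuple tnth s i; tnth s j] a = tnth s (u a).
  by rewrite /u; case: a => -[|[|//]] ?; rewrite (tnth_nth fset0).
split=> [a|a b n ab|a b n]; rewrite !uE //; last exact: ps2.
apply: ps1; move: ab; rewrite /u.
by case: a => -[|[|//]] ?; case: b => -[|[|//]] ?.
Qed.

(** With all coefficients 1 on k + 1 blocks, the lower l1 estimate grows like k and the upper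
    2-estimate like the root of k. *)
Lemma no_plegma_block_l1 (R : realType) (G : gfam R) (K : R) :
  tails_vanish G -> 0 <= K -> upper2 G K ->
  forall xi, ole (ofin 1) xi -> ~ admits_l1_plegma_block (gbasis G) xi.
Proof.
have pm1 : -1 <= (1 : R) <= 1 by apply/andP; split; lra.
move=> tailsG K0 upperG xi xi1 [F [m [x [rF oF mm [_ blkF]]]]].
move=> [E [p [e [_ _ [delta [_ delta0 gen]] [c [C [c0 C0 eqv]]]]]]].
have neF := has_order_nonempty oF xi1.
have /cvgrPdist_le/(_ 1 ltr01)[l0 _ dl0] := delta0.
have dl l : (l0 <= l)%N -> delta l <= 1.
  by move=> /dl0; rewrite sub0r normrN; apply: le_trans; exact: ler_norm.
(* M bounds the far out vectors: plegma 1-tuples compare |x_s| with the seminorm of e_0, at most C,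
   up to an error of at most 1. *)
pose M := C + 1.
have M0 : 0 < M by rewrite addr_gt0.
have xM s : restr F m s -> s != fset0 -> (m l0 <= elem s 0)%N -> `|x s| <= M.
  move=> Fs s0 ms.
  have s1F j : restr F m (tnth [tuple s] j) by rewrite ord1.
  have := gen 0%N l0 [tuple s] (fun=> 1) (leq0n _) s1F (plegma1 s0) ms.
  rewrite !big_ord1 !tnth0 !scale1r => H.
  have := (eqv 1%N (fun=> 1)).2; rewrite !big_ord1 scale1r normr1 mulr1 => eC.
  have /H H1 : forall j : 'I_1, -1 <= (1 : R) <= 1 by move=> _; exact: pm1.
  have := le_trans (ler_norm _) (le_trans H1 (dl _ (leqnn l0))); clear H H1.
  by rewrite /M; lra.
have main k : (l0 <= k)%N -> c * k.+1%:R <= 1 + Num.sqrt (K * k.+1%:R) * M.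
  move=> lk; have [s [sF ps ms]] := plegma_exists rF mm neF k k.
  have [s0 ps1 ps2] := ps.
  have := gen k k s (fun=> 1) (leqnn k) sF ps ms.
  under eq_bigr do rewrite scale1r.
  move=> H; have /H{}H : forall j : 'I_k.+1, -1 <= (1 : R) <= 1.
    by move=> _; exact: pm1.
  have := (eqv k.+1 (fun=> 1)).1.
  under eq_bigr do rewrite normr1.
  rewrite sumr_const card_ord => He.
  rewrite distrC in H; have {}H := le_trans (ler_norm _) (le_trans H (dl _ lk)).
  suff : `|\sum_(j < k.+1) x (tnth s j)| <= Num.sqrt (K * k.+1%:R) * M by lra.
  pose u j := x (nth fset0 s j).
  have uE (j : 'I_k.+1) : x (tnth s j) = u j by rewrite /u (tnth_nth fset0).
  under eq_bigr do rewrite uE.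
  have ord_lt (j : nat) (jk : (j < k.+1)%N) : u j = x (tnth s (Ordinal jk)).
    by rewrite uE.
  apply: (block_sum_norm K0 upperG (ltW M0)) => [i j a b ij jk|j jk].
    have ik := ltn_trans ij jk; rewrite (ord_lt _ ik) (ord_lt _ jk) => xa xb.
    have P2 := plegma_pair (i := Ordinal ik) (j := Ordinal jk) ps ij.
    by apply: (blkF _ _ (sF _) (sF _) P2); rewrite gbasis_supp.
  rewrite ord_lt; apply: xM => //.
  have mle : (m l0 <= m k)%N by move: lk; rewrite leq_eqVlt => /predU1P[->//|/mm/ltnW].
  apply: (leq_trans mle); apply: (leq_trans ms).
  case: (posnP j) => [j0|j0]; first by rewrite (_ : Ordinal jk = ord0)//; exact: val_inj.
  by rewrite ltnW// ps1// leq_min !cardfs_gt0 !s0.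
(* N = n + 1 exceeds 2/c, so that the error 1 is absorbed by c N / 2, and exceeds 4 M^2 K / c^2,
   which contradicts the squared inequality. *)
pose n := (maxn l0 (maxn (Num.truncn (2 / c)) (Num.truncn (4 * M ^+ 2 * K / c ^+ 2)))).
have nl0 : (l0 <= n)%N by exact: leq_maxl.
have n1 : 2 / c < n.+1%:R.
  by rewrite (lt_le_trans (truncnS_gt _))// ler_nat ltnS !leq_max leqnn orbT.
have n2 : 4 * M ^+ 2 * K / c ^+ 2 < n.+1%:R.
  by rewrite (lt_le_trans (truncnS_gt _))// ler_nat ltnS !leq_max leqnn !orbT.
have := main _ nl0; set N : R := n.+1%:R.
rewrite ltr_pdivrMr// in n1; rewrite ltr_pdivrMr ?exprn_gt0// in n2.
have N0 : 0 < N by rewrite ltr0n.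
move=> mainN; have sq : (N * c / 2) ^+ 2 <= M ^+ 2 * K * N.
  apply: (@le_trans _ _ ((Num.sqrt (K * N) * M) ^+ 2)).
    rewrite lerXn2r ?nnegrE ?divr_ge0 ?mulr_ge0 ?sqrtr_ge0//; [|exact: ltW..|].
      exact: ltW.
    by move: n1 mainN; rewrite -/N; lra.
  by rewrite exprMn sqr_sqrtr ?mulr_ge0//; lra.
have : 4 * M ^+ 2 * K * N < N * c ^+ 2 * N by rewrite ltr_pM2r.
by lra.
Qed.

(** * The space *)

Definition lev (n : nat) := logn 2 n.
Definition blk (n : nat) := logn 3 n.

Definition atom := (nat * seq (seq nat))%type.

Definition nodes (C : atom) : seq nat := flatten C.2.

(** Sizes are only bounded, so deleting nodes leaves an atom. Rows may then be empty, which breaks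
    transitivity of [allrel ltn]; hence [pairwise] instead of a condition on neighbours. *)
Definition atom_ok (C : atom) : Prop :=
  [/\ (size C.2 <= C.1.+1 ^ 2)%N,
      forall A, A \in C.2 -> [/\ uniq A, (size A <= C.1.+1)%N &
        {in A &, forall s t, lev s = lev t}]
    & pairwise (allrel ltn) C.2].

Definition blk_disjoint (C D : atom) : bool :=
  allrel (fun s t => blk s != blk t) (nodes C) (nodes D).

Definition collection (cs : seq atom) : Prop :=
  (forall C, C \in cs -> atom_ok C) /\ pairwise blk_disjoint cs.

Section Construction.
Variable R : realType.
Implicit Types (x y z : nat -> R^o) (C D : atom) (cs : seq atom).

Definition aval C x : R :=
  ((C.1.+1 ^ 2)%N%:R)^-1 * \sum_(A <- C.2) rowsum x A ^+ 2.

Definition gauge_of cs : seq (R * seq nat) :=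
  flatten [seq [seq (((C.1.+1 ^ 2)%N%:R)^-1, A) | A <- C.2] | C <- cs].

(** A finite section of the weighted l2-norm. The weights are small enough that L + 1 nodes with
    block number L and entries 1 contribute at most 1. *)
Definition wgauge N : seq (R * seq nat) :=
  [seq (((blk n).+1%:R ^+ 2)^-1, [:: n]) | n <- iota 0 N].

Definition space_gauge (g : seq (R * seq nat)) : Prop :=
  (exists N, g = wgauge N) \/ (exists2 cs, collection cs & g = gauge_of cs).

Lemma qf_gauge_of cs x : qf (gauge_of cs) x = \sum_(C <- cs) aval C x.
Proof.
rewrite /qf /gauge_of big_flatten big_map; apply: eq_bigr => C _.
by rewrite big_map /aval mulr_sumr.
Qed.

Lemma qf_wgauge N x :
  qf (wgauge N) x = \sum_(0 <= n < N) ((blk n).+1%:R ^+ 2)^-1 * x n ^+ 2.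
Proof.
rewrite /qf /wgauge big_map /index_iota subn0; apply: eq_bigr => n _ /=.
by rewrite /rowsum big_seq1 real_normK// num_real.
Qed.

Lemma aval_ge0 C x : 0 <= aval C x.
Proof. by rewrite mulr_ge0// sumr_ge0// => A _; exact: sqr_ge0. Qed.

Lemma space_gauge_nonneg g : space_gauge g -> nonneg g.
Proof.
move=> [[N ->]|[cs _ ->]] c; first by move=> /mapP[n _ ->] /=; rewrite invr_ge0 sqr_ge0.
by move=> /flatten_mapP[C _ /mapP[A _ ->]]; rewrite invr_ge0 ler0n.
Qed.

Definition single n : atom := (0%N, [:: [:: n]]).

Lemma single_ok n : atom_ok (single n).
Proof.
split=> // A; rewrite inE => /eqP ->; split=> // s t.
by rewrite !inE => /eqP -> /eqP ->.
Qed.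

Lemma aval_single n x : aval (single n) x = x n ^+ 2.
Proof.
by rewrite /aval/= exp1n invr1 mul1r big_seq1 /rowsum big_seq1 real_normK// num_real.
Qed.

Lemma space_gauge_coord n : exists2 g, space_gauge g & forall x, x n ^+ 2 <= qf g x.
Proof.
exists (gauge_of [:: single n]); last first.
  by move=> x; rewrite qf_gauge_of big_seq1 aval_single.
right; exists [:: single n] => //; split=> // C; rewrite inE => /eqP ->.
exact: single_ok.
Qed.

Lemma rowsum0 x A : {in A, forall t, x t = 0} -> rowsum x A = 0.
Proof.
move=> x0; rewrite /rowsum big_seq big1// => t tA.
by rewrite x0// normr0.
Qed.

Lemma aval0 C x : {in nodes C, forall t, x t = 0} -> aval C x = 0.
Proof.
move=> x0; rewrite /aval big_seq big1 ?mulr0// => A AC.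
rewrite rowsum0 ?expr0n// => t tA; apply: x0.
by apply/flattenP; exists A.
Qed.

(** A row has one level, so it meets the support of z at most once and contributes at most 1. The
    number of rows is at most the normalising factor, and by disjointness of block numbers only one
    atom meets z. *)
Lemma branch_collection_le1 z cs : collection cs ->
  (forall t, `|z t| <= 1) ->
  (forall s t, z s != 0 -> z t != 0 -> blk s = blk t) ->
  (forall s t, z s != 0 -> z t != 0 -> lev s = lev t -> s = t) ->
  qf (gauge_of cs) z <= 1.
Proof.
move=> [okcs pcs] z1 zblk zlev; rewrite qf_gauge_of.
have row1 C A : C \in cs -> A \in C.2 -> rowsum z A <= 1.
  move=> /okcs[_ rows _] /rows[uA _ levA].
  have [/hasP[t tA zt]|/hasPn nz] := boolP (has (fun t => z t != 0) A).
    rewrite /rowsum (bigD1_seq t)//= big_seq_cond big1 ?addr0// => s /andP[sA st].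
    apply/eqP; rewrite normr_eq0; apply: contraNT st => zs.
    by apply/eqP/zlev => //; exact: levA.
  by rewrite rowsum0// => t /nz /negPn/eqP.
have atom1 C : C \in cs -> aval C z <= 1.
  move=> Ccs; have [sC _ _] := okcs _ Ccs; rewrite /aval.
  rewrite ler_pdivrMl ?ltr0n ?expn_gt0// mulr1.
  apply: (@le_trans _ _ (\sum_(A <- C.2) 1)).
    rewrite !big_seq ler_sum// => A AC.
    by rewrite expr_le1// ?rowsum_ge0//; exact: row1 AC.
  by rewrite big_const_seq count_predT iter_addr_0 ler_nat.
elim: cs pcs {okcs row1} atom1 => [|C cs IH] /=; first by rewrite big_nil ler01.
move=> /andP[dis pcs] atom1; rewrite big_cons.
have [/hasP[t tC zt]|/hasPn nz] := boolP (has (fun t => z t != 0) (nodes C)).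
  rewrite big_seq big1 ?addr0; first by apply: atom1; rewrite inE eqxx.
  move=> D Dcs; apply: aval0 => s sD; apply/eqP; apply: contraT => zs.
  have /allrelP/(_ t s tC sD) := allP dis _ Dcs.
  by rewrite (zblk _ _ zt zs) eqxx.
rewrite aval0 ?add0r; first by apply: IH => // D Dcs; apply: atom1; rewrite inE Dcs orbT.
by move=> t /nz /negPn/eqP.
Qed.

Lemma space_gauge_unit n g : space_gauge g -> qf g (delta_seq R n) <= 1.
Proof.
have dn t : delta_seq R n t != 0 -> t = n.
  by rewrite /delta_seq; case: (t =P n) => // _; rewrite eqxx.
move=> [[N ->]|[cs ccs ->]]; last first.
  apply: branch_collection_le1 => // [t|s t /dn -> /dn ->|s t /dn -> /dn ->]//.
  by rewrite /delta_seq; case: (t == n); rewrite ?normr1 ?normr0 ?ler01.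
rewrite qf_wgauge; have [nN|nN] := boolP (n \in index_iota 0 N).
  rewrite (bigD1_seq n)//= ?iota_uniq// big1; last first.
    by move=> i /negPf ni; rewrite /delta_seq ni expr0n mulr0.
  rewrite addr0 /delta_seq eqxx expr1n mulr1 invf_le1 ?exprn_gt0//.
  by rewrite expr_ge1 ?ler0n// ler1n.
rewrite big_seq big1 ?ler01// => i iN; rewrite /delta_seq (_ : i == n = false).
  by rewrite expr0n mulr0.
by apply: contraNF nN => /eqP <-.
Qed.

Definition space_gauges : gfam R := GFam space_gauge_nonneg space_gauge_coord space_gauge_unit.

Lemma sqr_rowsum_le x A : rowsum x A ^+ 2 <= (size A)%:R * \sum_(t <- A) x t ^+ 2.
Proof.
rewrite [rowsum x A](_ : _ = \sum_(t <- A) 1 * `|x t| * 1); last first.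
  by apply: eq_bigr => t _; rewrite mul1r mulr1.
apply: le_trans (cauchy_schwarz_seq _ _ (fun _ _ => ler01)) _.
rewrite mulrC [X in X * _](_ : _ = (size A)%:R); last first.
  under eq_bigr do rewrite expr1n mulr1.
  by rewrite big_const_seq count_predT iter_addr_0.
by rewrite ler_wpM2l// ler_sum// => t _; rewrite mul1r real_normK// num_real.
Qed.

(** * The upper estimate for one atom under a division into intervals *)

Section UpperEstimate.
Variables (piece : nat -> nat) (n : nat) (x : nat -> R^o).
Hypothesis piece_homo : {homo piece : i j / (i <= j)%N}.
Hypothesis xn : forall t, x t != 0 -> (piece t < n)%N.

Let y j := cut (fun t => piece t == j) x.
Let whole (A : seq nat) := allrel (fun s t => piece s == piece t) A A.
Let meets j (A : seq nat) := has (fun t => piece t == j) A.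

(** A row lying between two rows that meet the interval j is contained in it, so only the first and
    the last row meeting the interval can be split. *)
Lemma split_rows_le2 j rows : pairwise (allrel ltn) rows ->
  (count (fun A => ~~ whole A && meets j A) rows <= 2)%N.
Proof.
move=> prows; rewrite -size_filter leqNgt; apply/negP.
set f := seq.filter _ _; have pf : pairwise (allrel ltn) f by exact: pairwise_filter.
have : all (fun A => ~~ whole A && meets j A) f by exact: filter_all.
move: pf; case: f => [|A [|B [|D f]]]//=.
move=> /andP[/and3P[/allrelP AB _ _] /andP[/andP[/allrelP BD _] _]].
move=> /and4P[/andP[_ /hasP[s sA /eqP js]] /andP[wB _] /andP[_ /hasP[u uD /eqP ju]] _] _.
have jB t : t \in B -> piece t = j.
  move=> tB; apply/eqP; rewrite eqn_leq; apply/andP; split.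
    by rewrite -ju; apply: piece_homo; apply: ltnW; exact: BD.
  by rewrite -js; apply: piece_homo; apply: ltnW; exact: AB.
by move/negP: wB; apply; apply/allrelP => a b aB bB; rewrite !jB.
Qed.

Lemma cut_sqr_sum t : x t ^+ 2 = \sum_(j < n) y j t ^+ 2.
Proof.
have [xt|xt] := eqVneq (x t) 0.
  by rewrite xt big1 ?expr0n// => j _; rewrite /y /cut xt if_same expr0n.
rewrite (bigD1 (Ordinal (xn xt)))//= /y /cut eqxx big1 ?addr0// => j jt.
rewrite (_ : piece t == j = false) ?expr0n//.
by apply: contraNF jt => /eqP jt; apply/eqP/val_inj.
Qed.

(** An unsplit row with a nonzero entry lies in one interval. On a split row Cauchy-Schwarz costs
    one factor k + 1, and summing at most k + 1 squares bounded by [Mx j] costs another. *)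
Lemma row_upper k (Mx : nat -> R) A : (size A <= k.+1)%N ->
  (forall j, 0 <= Mx j) ->
  (forall j t, t \in A -> y j t ^+ 2 <= Mx j) ->
  rowsum x A ^+ 2 <= \sum_(j < n) (rowsum (y j) A ^+ 2 +
    (~~ whole A && meets j A)%:R * ((k.+1 ^ 2)%N%:R * Mx j)).
Proof.
move=> Ak Mx0 yM; have [wA|sA] := boolP (whole A) => /=.
  under eq_bigr do rewrite mul0r addr0.
  have sum0 : 0 <= \sum_(j < n) rowsum (y j) A ^+ 2.
    by rewrite sumr_ge0// => j _; exact: sqr_ge0.
  have [/hasP[a aA xa]|/hasPn nz] := boolP (has (fun t => x t != 0) A); last first.
    by rewrite rowsum0 ?expr0n// => t /nz /negPn/eqP.
  rewrite (bigD1 (Ordinal (xn xa)))//= -[leLHS]addr0 lerD ?sumr_ge0//.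
    rewrite lerXn2r ?nnegrE ?rowsum_ge0// ler_rowsum// => t tA.
    by rewrite /y /cut (allrelP wA _ _ tA aA).
  by move=> j _; exact: sqr_ge0.
apply: (le_trans (sqr_rowsum_le _ _)).
rewrite (eq_bigr _ (fun t _ => cut_sqr_sum t)).
rewrite exchange_big/= mulr_sumr ler_sum// => j _.
rewrite -[leLHS]add0r lerD ?sqr_ge0//.
have [mA|/hasPn nm] := boolP (meets j A); last first.
  rewrite mul0r big_seq big1 ?mulr0// => t /nm /negPf tj.
  by rewrite /y /cut tj expr0n.
rewrite mul1r expnS expn1 natrM -mulrA ler_pM ?ler_nat ?sumr_ge0//.
  by move=> t _; exact: sqr_ge0.
apply: (@le_trans _ _ (\sum_(t <- A) Mx j)).
  by rewrite !big_seq ler_sum// => t tA; exact: yM.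
rewrite big_const_seq count_predT iter_addr_0 -[leLHS]mulr_natl ler_wpM2r//.
by rewrite ler_nat.
Qed.

(** The normalisation cancels the cost (k + 1)^2 of a split row, and each interval splits at most
    two rows. *)
Lemma atom_upper C (Mx : nat -> R) : atom_ok C -> (forall j, 0 <= Mx j) ->
  (forall j t, t \in nodes C -> y j t ^+ 2 <= Mx j) ->
  aval C x <= \sum_(j < n) (aval C (y j) + 2 * Mx j).
Proof.
move=> [_ rows pC] Mx0 yM; set L : R := (C.1.+1 ^ 2)%N%:R.
have L0 : 0 < L by rewrite ltr0n expn_gt0.
rewrite /aval -/L ler_pdivrMl//.
apply: (@le_trans _ _ (\sum_(A <- C.2) \sum_(j < n) (rowsum (y j) A ^+ 2 +
    (~~ whole A && meets j A)%:R * (L * Mx j)))).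
  rewrite !big_seq ler_sum// => A AC; apply: row_upper => //.
    by have [] := rows _ AC.
  by move=> j t tA; apply: yM; apply/flattenP; exists A.
rewrite exchange_big/= mulr_sumr ler_sum// => j _.
rewrite big_split/= mulrDr mulVKf ?gt_eqF// lerD2l.
rewrite -mulr_suml -natr_sum [leRHS]mulrCA.
apply: ler_wpM2r; first by rewrite mulr_ge0// ltW.
rewrite ler_nat (leq_trans _ (split_rows_le2 j pC))// -sum1_count [leqRHS]big_mkcond.
by apply: leq_sum => A _; case: (_ && _).
Qed.

End UpperEstimate.

(** The largest coordinate on the nodes of C is the value of a one-node atom, so the sup norm is
    controlled by an atom inside C; if C has no nodes, an atom without rows serves. *)
Lemma ex_single_dominating C z : exists D, [/\ atom_ok D,
  {subset nodes D <= nodes C} & forall t, t \in nodes C -> z t ^+ 2 <= aval D z].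
Proof.
have ex_max (s : seq nat) : s != [::] ->
    exists2 t, t \in s & forall u, u \in s -> z u ^+ 2 <= z t ^+ 2.
  elim: s => [//|a s IH] _; have [->|/IH[t ts tmax]] := eqVneq s [::].
    by exists a => [|u]; rewrite inE// => /eqP ->.
  have [at_|ta] := leP (z a ^+ 2) (z t ^+ 2).
    by exists t => [|u]; rewrite inE ?ts ?orbT// => /predU1P[->|/tmax].
  exists a => [|u]; first by rewrite inE eqxx.
  by rewrite inE => /predU1P[->//|/tmax /le_trans]; apply; exact: ltW.
have [C0|/ex_max[t tC tmax]] := eqVneq (nodes C) [::].
  by exists (0%N, [::]); split=> // t; rewrite C0.
exists (single t); split; first exact: single_ok.
  by move=> u; rewrite inE => /eqP ->.
by move=> u /tmax; rewrite aval_single.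
Qed.

Lemma collection_sub cs (h : atom -> atom) : collection cs ->
  (forall C, C \in cs -> atom_ok (h C)) ->
  (forall C, {subset nodes (h C) <= nodes C}) -> collection [seq h C | C <- cs].
Proof.
move=> [_ pcs] okh subh; split; first by move=> _ /mapP[C Ccs ->]; exact: okh.
rewrite pairwise_map; apply: sub_pairwise pcs => C D /allrelP CD.
by apply/allrelP => s t /subh sC /subh tD; exact: CD.
Qed.

(** Of the constant 3, the given collection contributes 1 and the split rows 2. The latter are
    charged to the collection obtained by replacing each atom with a dominating one inside it. *)
Lemma space_upper2 : upper2 space_gauges 3.
Proof.
move=> piece n x c piece_homo xn xc g Gg.
have [n0|n0] := posnP n.
  rewrite n0 mulr0 mul0r /qf big1// => -[w A] _ /=; rewrite rowsum0 ?expr0n ?mulr0//.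
  by move=> t _; apply/eqP; apply: contraT => /xn; rewrite n0.
have c0 : 0 <= c.
  by apply: le_trans (xc 0%N g n0 Gg); apply: qf_ge0; exact: space_gauge_nonneg Gg.
have sumc (f : nat -> R) : (forall j, (j < n)%N -> f j <= c) ->
    \sum_(j < n) f j <= n%:R * c.
  move=> fc; apply: (@le_trans _ _ (\sum_(j < n) c)).
    by apply: ler_sum => j _; exact: fc.
  by rewrite sumr_const card_ord mulr_natl.
case: Gg => [[N gE]|[cs ccs ->]].
  (* The weighted l2 part is additive over the intervals, so constant 1 suffices here. *)
  apply: (@le_trans _ _ (n%:R * c)); last first.
    by rewrite -mulrA ler_peMl ?mulr_ge0// ler1n.
  rewrite gE qf_wgauge.
  rewrite (eq_bigr (fun i => \sum_(j < n) ((blk i).+1%:R ^+ 2)^-1 *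
      cut (fun t => piece t == j) x i ^+ 2)); last first.
    by move=> i _; rewrite -mulr_sumr -cut_sqr_sum.
  rewrite exchange_big/=; under eq_bigr do rewrite -qf_wgauge.
  apply: (sumc (fun j => qf (wgauge N) (cut (fun t => piece t == j) x))) => j jn.
  by apply: xc => //; left; exists N.
have /choice[D DP] (jC : nat * atom) : exists D, [/\ atom_ok D,
    {subset nodes D <= nodes jC.2} & forall t, t \in nodes jC.2 ->
    cut (fun t => piece t == jC.1) x t ^+ 2 <= aval D (cut (fun t => piece t == jC.1) x)].
  exact: ex_single_dominating.
rewrite qf_gauge_of.
apply: (@le_trans _ _ (\sum_(C <- cs) \sum_(j < n)
    (aval C (cut (fun t => piece t == j) x) +
     2 * aval (D (nat_of_ord j, C)) (cut (fun t => piece t == j) x)))).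
  rewrite !big_seq ler_sum// => C Ccs.
  apply: (@atom_upper piece n x piece_homo xn C
    (fun j => aval (D (j, C)) (cut (fun t => piece t == j) x))).
  - exact: ccs.1.
  - by move=> j; exact: aval_ge0.
  - by move=> j t tC; have [_ _] := DP (j, C); apply.
rewrite exchange_big/= -[3 * _ * _]mulrA mulrCA.
have : forall j, (j < n)%N -> \sum_(C <- cs)
    (aval C (cut (fun t => piece t == j) x) +
     2 * aval (D (j, C)) (cut (fun t => piece t == j) x)) <= 3 * c; last first.
  move=> H; apply: (@le_trans _ _ (\sum_(j < n) (3 * c))).
    by apply: ler_sum => j _; exact: H.
  by rewrite sumr_const card_ord -[leLHS]mulr_natl.
move=> j jn; rewrite big_split/= -mulr_sumr (_ : 3 * c = c + 2 * c); last by ring.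
apply: lerD; first by rewrite -qf_gauge_of; apply: xc => //; right; exists cs.
rewrite ler_pM2l// -(big_map (fun C => D (j, C)) predT
  (fun C => aval C (cut (fun t => piece t == j) x))) -qf_gauge_of.
apply: xc => //; right; eexists; last by [].
by apply: collection_sub => // C; have [] := DP (j, C).
Qed.

Lemma uniq_sum_le (s : seq nat) (a : nat -> R) c : uniq s ->
  (forall n, 0 <= a n) -> (forall N, \sum_(0 <= n < N) a n <= c) ->
  \sum_(t <- s) a t <= c.
Proof.
move=> us a0 ac; set N := (\max_(t <- s) t).+1.
apply: le_trans (ac N); rewrite /index_iota subn0.
have st : {subset s <= iota 0 N}.
  by move=> t ts; rewrite mem_iota add0n ltnS/=; exact: (@leq_bigmax_seq _ _ xpredT id).
rewrite (perm_big [seq i <- iota 0 N | i \in s]); last first.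
  apply: uniq_perm => //; first by rewrite filter_uniq// iota_uniq.
  by move=> t; rewrite mem_filter; case: (boolP (t \in s)) => // /st ->.
rewrite big_filter big_mkcond ler_sum// => i _.
by case: ifP.
Qed.

Lemma nodes_uniq C : atom_ok C -> uniq (nodes C).
Proof.
case: C => k rows [_ /= ok prows]; rewrite /nodes /=.
elim: rows prows ok => //= A rows IH /andP[/allP Ar prows] ok.
rewrite cat_uniq IH//; last by move=> B Br; apply: ok; rewrite inE Br orbT.
have [-> _ _] /= := ok A (mem_head _ _); rewrite andbT.
apply/hasPn => t /flattenP[B Br tB]; apply/negP => tA.
by have /allrelP/(_ t t tA tB) := Ar _ Br; rewrite /= ltnn.
Qed.

Lemma collection_nodes_uniq cs : collection cs ->
  uniq (flatten [seq nodes C | C <- cs]).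
Proof.
move=> [ok]; elim: cs ok => //= C cs IH ok /andP[/allP dis pcs].
rewrite cat_uniq IH//; last by move=> D Dcs; apply: ok; rewrite inE Dcs orbT.
rewrite nodes_uniq ?mem_head//=; last by apply: ok; exact: mem_head.
rewrite andbT; apply/hasPn => t /flatten_mapP[D Dcs tD]; apply/negP => tC.
by have /allrelP/(_ t t tC tD) := dis _ Dcs; rewrite eqxx.
Qed.

(** A row of size at most k + 1 satisfies rowsum^2 <= (k + 1) times its sum of squares, below the
    normalisation (k + 1)^2, and no node occurs twice in a collection. *)
Lemma collection_le_l2 cs z c : collection cs ->
  (forall N, \sum_(0 <= n < N) z n ^+ 2 <= c) -> qf (gauge_of cs) z <= c.
Proof.
move=> ccs zc; have zs := uniq_sum_le (collection_nodes_uniq ccs)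
  (fun n => sqr_ge0 (z n)) zc.
apply: le_trans zs; rewrite qf_gauge_of big_flatten big_map/= !big_seq ler_sum// => C Ccs.
have [_ rows _] := ccs.1 _ Ccs.
rewrite /aval ler_pdivrMl ?ltr0n ?expn_gt0// big_flatten/= mulr_sumr.
rewrite !big_seq ler_sum// => A /rows[_ sA _].
apply: (le_trans (sqr_rowsum_le _ _)); rewrite ler_wpM2r ?sumr_ge0//.
  by move=> t _; exact: sqr_ge0.
by rewrite ler_nat (leq_trans sA)// expnS expn1 leq_pmulr.
Qed.

End Construction.

(** * Bounded completeness of the space *)

Section Tails.
Variable R : realType.
Implicit Types (x y z : nat -> R^o) (C D : atom) (cs : seq atom).

Lemma sum_tail_le (a : nat -> R) (B e : R) : (forall n, 0 <= a n) ->
  (forall N, \sum_(0 <= n < N) a n <= B) -> 0 < e ->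
  exists N, forall M, \sum_(0 <= n < M) (if (N <= n)%N then a n else 0) <= e.
Proof.
move=> a0 aB e0.
pose E := [set \sum_(0 <= n < N) a n | N in [set: nat]].
have sE : has_sup E.
  split; first by exists (\sum_(0 <= n < 0) a n), 0%N.
  by exists B => _ [N _ <-].
have [_ [N _ <-] supN] := sup_adherent e0 sE.
exists N => M; have [MN|NM] := leqP M N.
  rewrite big_nat big1 ?ltW// => n /andP[_ nM].
  by rewrite leqNgt (leq_trans nM MN).
rewrite (big_cat_nat (leq0n N) (ltnW NM))/= [X in X + _]big_nat big1 ?add0r; last first.
  by move=> n /andP[_ nN]; rewrite leqNgt nN.
have -> : \sum_(N <= n < M) (if (N <= n)%N then a n else 0) = \sum_(N <= n < M) a n.
  by apply: eq_big_nat => n /andP[-> _].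
have : \sum_(0 <= n < M) a n <= sup E by apply: sup_upper_bound => //; exists M.
rewrite (big_cat_nat (leq0n N) (ltnW NM))/=.
by move: supN; lra.
Qed.

Lemma qf_gauge_of_cat cs cs' x :
  qf (gauge_of R (cs ++ cs')) x = qf (gauge_of R cs) x + qf (gauge_of R cs') x.
Proof. by rewrite !qf_gauge_of big_cat. Qed.

(** Moves a cut from the vector to the gauge, so that values on a cut vector become values on the
    whole vector. *)
Definition afilter (P : pred nat) C : atom := (C.1, map (seq.filter P) C.2).

Lemma rowsum_cut P x A : rowsum (cut P x) A = rowsum x (seq.filter P A).
Proof.
rewrite /rowsum big_filter [RHS]big_mkcond; apply: eq_bigr => t _.
by rewrite /cut; case: ifP => _; rewrite ?normr0.
Qed.

Lemma aval_cut P C x : aval C (cut P x) = aval (afilter P C) x.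
Proof.
rewrite /aval /= big_map; congr (_ * _); apply: eq_bigr => A _.
by rewrite rowsum_cut.
Qed.

Lemma nodes_afilter P C t : (t \in nodes (afilter P C)) = (t \in nodes C) && P t.
Proof.
apply/flattenP/andP => [[_ /mapP[A AC ->]]|[/flattenP[A AC tA] Pt]].
  by rewrite mem_filter => /andP[Pt tA]; split=> //; apply/flattenP; exists A.
by exists (seq.filter P A); [exact: map_f | rewrite mem_filter Pt].
Qed.

Lemma afilter_ok P C : atom_ok C -> atom_ok (afilter P C).
Proof.
move=> [sC rows pC]; split; first by rewrite size_map.
  move=> _ /mapP[A AC ->]; have [uA sA lA] := rows _ AC; split.
  - exact: filter_uniq.
  - by rewrite size_filter (leq_trans (count_size _ _)).
  - by move=> s t; rewrite !mem_filter => /andP[_ sA'] /andP[_ tA']; exact: lA.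
rewrite /= pairwise_map; apply: sub_pairwise pC => A B /allrelP AB.
apply/allrelP => s t; rewrite !mem_filter => /andP[_ sA] /andP[_ tB].
exact: AB.
Qed.

Lemma collection_afilter P cs : collection cs ->
  collection [seq afilter P C | C <- cs].
Proof.
move=> ccs; apply: collection_sub => // C; first by move=> /ccs.1/afilter_ok.
by move=> t; rewrite nodes_afilter => /andP[].
Qed.

Lemma qf_afilter P cs x :
  qf (gauge_of R cs) (cut P x) = qf (gauge_of R [seq afilter P C | C <- cs]) x.
Proof.
by rewrite !qf_gauge_of big_map; apply: eq_bigr => C _; rewrite aval_cut.
Qed.

Lemma qf_le2D (g : seq (R * seq nat)) x u v : nonneg g ->
  (forall t, `|x t| <= `|u t| + `|v t|) -> qf g x <= 2 * qf g u + 2 * qf g v.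
Proof.
move=> g0 xuv; rewrite /qf !mulr_sumr -big_split/= !big_seq ler_sum// => c /g0 c0.
have rs : rowsum x c.2 <= rowsum u c.2 + rowsum v c.2.
  by rewrite /rowsum -big_split/= ler_sum.
apply: (@le_trans _ _ (c.1 * (rowsum u c.2 + rowsum v c.2) ^+ 2)).
  by rewrite ler_wpM2l// lerXn2r ?nnegrE ?addr_ge0 ?rowsum_ge0.
rewrite -subr_ge0 (_ : _ - _ = c.1 * (rowsum u c.2 - rowsum v c.2) ^+ 2); last by ring.
by rewrite mulr_ge0// sqr_ge0.
Qed.

(* Cutting at a block index [p] beyond a nearly norming collection leaves only
   a small part above [p]; below [p] the weighted l2 norm controls the norm. *)
Lemma space_tails_vanish : tails_vanish (space_gauges R).
Proof.
move=> x e /gboundedP[B B0 xB] e0.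
have e8 : 0 < e / 8 by rewrite divr_gt0.
pose E := [set qf (gauge_of R cs) x | cs in collection].
have sE : has_sup E.
  split; first by exists (qf (gauge_of R [::]) x), [::].
  by exists (B ^+ 2) => _ [cs ccs <-]; apply: xB; right; exists cs.
have [_ [cs0 ccs0 <-] sup0] := sup_adherent e8 sE.
pose p := (\max_(t <- flatten [seq nodes C | C <- cs0]) blk t).+1.
have cs0p C t : C \in cs0 -> t \in nodes C -> (blk t < p)%N.
  move=> Ccs tC; rewrite ltnS; apply: (@leq_bigmax_seq _ _ xpredT) => //.
  by apply/flatten_mapP; exists C.
have high cs : collection cs -> qf (gauge_of R cs) (cut (fun t => p <= blk t)%N x) <= e / 8.
  move=> ccs; rewrite qf_afilter; set cs' := map _ _.
  have ccs' : collection cs' by exact: collection_afilter.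
  (* [cs0] uses block numbers below p and [cs'] only those from p on, so together they form a
     collection. As [cs0] nearly attains the supremum, at most e/8 is left for [cs']. *)
  have : qf (gauge_of R (cs0 ++ cs')) x <= sup E.
    apply: sup_upper_bound => //; exists (cs0 ++ cs') => //; split.
      by move=> C; rewrite mem_cat => /orP[/ccs0.1|/ccs'.1].
    rewrite pairwise_cat ccs0.2 ccs'.2 !andbT; apply/allrelP => C _ Ccs /mapP[D _ ->].
    apply/allrelP => s t sC; rewrite nodes_afilter => /andP[_ pt].
    by rewrite neq_ltn (leq_trans (cs0p _ _ Ccs sC) pt).
  by rewrite qf_gauge_of_cat; move: sup0; lra.
pose z := cut (fun t => blk t < p)%N x.
pose w n : R := ((blk n).+1%:R ^+ 2)^-1.
have w0 n : 0 < w n by rewrite invr_gt0 exprn_gt0.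
have wB N : \sum_(0 <= n < N) w n * x n ^+ 2 <= B ^+ 2.
  by rewrite -qf_wgauge; apply: xB; left; exists N.
have z0 n : 0 <= z n ^+ 2 by exact: sqr_ge0.
(* On block numbers below p the weights are at least p^-2, so the weighted bound gives an l2
   bound. *)
have zB N : \sum_(0 <= n < N) z n ^+ 2 <= p%:R ^+ 2 * B ^+ 2.
  apply: le_trans (ler_wpM2l (sqr_ge0 _) (wB N)).
  rewrite mulr_sumr ler_sum// => n _; rewrite mulrA /z /cut; case: ifPn => [np|_].
    rewrite -[leLHS]mul1r ler_wpM2r ?sqr_ge0// ler_pdivlMr ?exprn_gt0// mul1r.
    by rewrite lerXn2r ?nnegrE// ler_nat.
  by rewrite expr0n mulr_ge0 ?sqr_ge0// mulr_ge0 ?sqr_ge0// ltW.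
have wx0 n : 0 <= w n * x n ^+ 2 by rewrite mulr_ge0 ?sqr_ge0// ltW.
have [N1 N1P] := sum_tail_le z0 zB e8.
have [N2 N2P] := sum_tail_le wx0 wB e0.
exists (maxn N1 N2) => g Gg; have g0 : nonneg g by exact: space_gauge_nonneg Gg.
case: (Gg) => [[M gE]|[cs ccs gE]].
  rewrite gE qf_wgauge; apply: le_trans (N2P M); rewrite ler_sum// => n _.
  rewrite /cut geq_max; case: (leqP N2 n) => [_|_]; last first.
    by rewrite andbF expr0n mulr0.
  rewrite andbT; case: ifP => // _; rewrite expr0n mulr0 mulr_ge0 ?sqr_ge0//.
  exact: ltW.
(* Both parts are at most e/8, so the total is at most e/2. *)
apply: le_trans (_ : _ <= 2 * qf g (cut (fun t => p <= blk t)%N x) +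
                          2 * qf g (cut (leq N1) z)) _.
  apply: qf_le2D => // t; rewrite /cut geq_max /z /cut.
  case: (leqP N1 t) => _ /=; last by rewrite normr0 addr_ge0.
  case: (leqP p (blk t)) => _; rewrite ?normr0 ?addr0 ?add0r; case: ifP => // _;
  by rewrite normr0.
have lo : qf g (cut (leq N1) z) <= e / 8.
  rewrite gE; apply: collection_le_l2 => // M.
  apply: le_trans (N1P M); rewrite ler_sum// => n _; rewrite /cut.
  by case: ifP => // _; rewrite expr0n.
have hi := high _ ccs; rewrite -gE in hi.
by lra.
Qed.

End Tails.

(** * The family of sets with |s| = min s *)

Lemma ole_refl a : ole a a.
Proof. by elim: a => //= f IH i; exists i; exact: IH. Qed.

Lemma ole_ofin i j : (i <= j)%N -> ole (ofin i) (ofin j).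
Proof. by elim: i j => [|i IH] [|j]//= ij _; exists 0%N; exact: IH. Qed.

(* In one-based terms this is |s| = min s: the element n of nat stands for n + 1. *)
Definition schreier : set {fset nat} := [set s | #|` s| = (elem s 0).+1].

Section Schreier.
Implicit Types s t : {fset nat}.

Lemma elem0_le s x : x \in s -> (elem s 0 <= x)%N.
Proof.
rewrite -mem_elems => /(nthP 0%N)[[|i] si <-] //.
by rewrite ltnW// elem_ltn// -size_elems.
Qed.

Lemma initial_elem0 t s : initial t s -> t != fset0 -> elem t 0 = elem s 0.
Proof.
move=> /prefixP[r sE]; rewrite -cardfs_gt0 -size_elems /elem sE.
by case: (elems t).
Qed.

Lemma initial_card t s : initial t s -> (#|` t| <= #|` s|)%N.
Proof. by rewrite -!size_elems; exact: size_prefix. Qed.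

Lemma proper_initial_card t s : proper_initial t s -> (#|` t| < #|` s|)%N.
Proof.
move=> /andP[ts tns]; rewrite ltn_neqAle initial_card// andbT.
apply: contraNneq tns => ct; move: ts; rewrite /initial => /prefixP[r sE].
apply/eqP/elems_inj; move/(congr1 size): (sE); rewrite size_cat !size_elems -ct.
by rewrite -[LHS]addn0 => /addnI/esym/size0nil r0; rewrite sE r0 cats0.
Qed.

(** Appending elements above max t keeps the minimum and raises the cardinality by one each time,
    until a member of the family is reached; the induction is on the number of missing elements. *)
Lemma hat_schreierP t : hat schreier t <-> (#|` t| <= (elem t 0).+1)%N.
Proof.
split=> [[s Fs ts]|tc].
  have [->|t0] := eqVneq t fset0; first by rewrite cardfs0.
  by rewrite (initial_elem0 ts t0) -Fs initial_card.
have [d dE] : exists d, (#|` t| + d = (elem t 0).+1)%N.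
  by exists ((elem t 0).+1 - #|` t|)%N; rewrite subnKC.
elim: d t tc dE => [|d IH] t tc dE.
  by exists t; [rewrite /schreier/= -dE addn0 | exact: prefix_refl].
pose q := (\max_(x <- t) x).+1.
have tq x : x \in t -> (x < q)%N by move=> xt; rewrite ltnS; exact: (@leq_bigmax_seq _ _ xpredT).
(* The empty set has no minimum to preserve and is completed directly to {0}. *)
have [t0|t0] := eqVneq t fset0.
  exists [fset x in [:: 0%N]]%fset; last by rewrite /initial t0 elems0 prefix0s.
  by rewrite /schreier/= -size_elems /elem !elems_seq.
have i1 : initial t (q |` t)%fset by rewrite /initial elemsU1// prefix_rcons.
have e1 := initial_elem0 i1 t0.
have c1 : #|` (q |` t)%fset| = #|` t|.+1.
  by rewrite -!size_elems elemsU1// size_rcons.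
have [||s Fs i2] := IH (q |` t)%fset.
- by rewrite c1 -e1 -dE addnS ltnS leq_addr.
- by rewrite c1 -e1 -dE addnS.
by exists s => //; exact: prefix_trans i1 i2.
Qed.

Lemma schreier_hereditary : hereditary (hat schreier).
Proof.
move=> s t /hat_schreierP sc ts; apply/hat_schreierP.
have [->|t0] := eqVneq t fset0; first by rewrite cardfs0.
apply: (leq_trans (fsubset_leq_card ts)); apply: (leq_trans sc).
rewrite ltnS; apply: elem0_le; apply: (fsubsetP ts); apply: elem_mem.
by rewrite cardfs_gt0.
Qed.

Lemma schreier_spreading : spreading (hat schreier).
Proof.
move=> s t /hat_schreierP sc ts st; apply/hat_schreierP.
have [t0|t0] := posnP #|` t|; first by rewrite t0.
by rewrite ts (leq_trans sc)// ltnS st// -ts.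
Qed.

(** The first element of a limit c bounds the size of all its finite sections, so the sections
    stabilise and c is itself a finite set of the hat. *)
Lemma schreier_compact : compact_family (hat schreier).
Proof.
apply/closed_cantorP => c cP.
pose l n := seq.filter c (iota 0 n).
have l_sorted n : sorted ltn (l n).
  by apply: sorted_filter; [exact: ltn_trans | exact: iota_ltn_sorted].
pose S n := [fset x in l n]%fset.
have SE n : elems (S n) = l n by exact: elems_seq.
have lS n : l n.+1 = if c n then rcons (l n) n else l n.
  by rewrite /l -[n.+1]addn1 iotaD filter_cat/= add0n; case: (c n); rewrite ?cats1 ?cats0.
have memS n x : (x \in S n) = c x && (x < n)%N.
  by rewrite -mem_elems SE mem_filter mem_iota add0n.
have hS n : hat schreier (S n).
  have [_ [s hs <-] sc] := cP n; apply: schreier_hereditary hs _.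
  by apply/fsubsetP => x; rewrite memS => /andP[cx xn]; have := sc _ xn; rewrite cx.
have size_mono i j : (i <= j)%N -> (size (l i) <= size (l j))%N.
  elim: j => [|j IH]; rewrite leq_eqVlt => /predU1P[->//|]; rewrite // ltnS => /IH ij.
  by rewrite lS; case: ifP; rewrite ?size_rcons// => _; exact: leqW.
have [B lB] : exists B, forall n, (size (l n) <= B)%N.
  have [[n0 ln0]|H] := pselect (exists n, (0 < size (l n))%N); last first.
    by exists 0%N => n; rewrite leqNgt; apply/negP => ln; apply: H; exists n.
  exists (nth 0%N (l n0) 0).+1 => n.
  have nth_l j : (n0 <= j)%N -> (0 < size (l j))%N && (nth 0%N (l j) 0 == nth 0%N (l n0) 0).
    elim: j => [|j IH]; first by rewrite leqn0 => /eqP n00; move: ln0; rewrite n00 eqxx => ->.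
    rewrite leq_eqVlt => /predU1P[<-|]; first by rewrite ln0 eqxx.
    rewrite ltnS => /IH /andP[lj /eqP <-]; rewrite lS; case: ifP => _; last by rewrite lj eqxx.
    by rewrite size_rcons nth_rcons lj eqxx.
  apply: leq_trans (size_mono _ _ (leq_maxl n n0)) _.
  have /andP[_ /eqP <-] := nth_l _ (leq_maxr n n0).
  by have /hat_schreierP := hS (maxn n n0); rewrite -size_elems /elem SE.
(* At a section of maximal size no later element can belong to c. *)
have [N NP] : exists N, forall n, (size (l n) <= size (l N))%N.
  have exP : exists k, `[< exists n, size (l n) = k >].
    by exists (size (l 0)); apply/asboolP; exists 0%N.
  have bP k : `[< exists n, size (l n) = k >] -> (k <= B)%N by move=> /asboolP[n <-].
  case: (ex_maxnP exP bP) => k /asboolP[N <-] kmax; exists N => n.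
  by apply: kmax; apply/asboolP; exists n.
exists (S N) => //; apply/funext => x; rewrite /char_fun memS.
case: ltnP => [_|Nx]; first by rewrite andbT.
rewrite andbF; apply/esym/negP => cx.
by have := NP x.+1; rewrite lS cx size_rcons ltnNge size_mono.
Qed.

Lemma schreier_regular_thin : regular_thin schreier.
Proof.
split; last by split;
  [exact: schreier_hereditary|exact: schreier_spreading|exact: schreier_compact].
move=> s t Fs Ft; apply/negP => pst; have := proper_initial_card pst.
rewrite Fs Ft (initial_elem0 (andP pst).1) ?ltnn//.
by rewrite -cardfs_gt0 Fs.
Qed.

(** A nonempty node is ranked by the number of elements still missing for membership. *)
Definition schreier_rank s : cord :=
  if s == fset0 then oomega else ofin ((elem s 0).+1 - #|` s|).

Lemma schreier_rankP : is_rank schreier schreier_rank.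
Proof.
move=> s /hat_schreierP hs; have [s0|s0] := eqVneq s fset0.
  rewrite /schreier_rank s0 eqxx; split.
    move=> _ [t [_ /andP[_ t0]] <-]; rewrite eq_sym (negPf t0) => i.
    by eexists; exact: ole_refl.
  (* The singleton {i} has rank i, so the root has rank at least omega. *)
  move=> c cP; have ci i : ole (osucc (ofin i)) c.
    apply: cP; exists [fset x in [:: i]]%fset.
      have elE : elems [fset x in [:: i]]%fset = [:: i] by exact: elems_seq.
      split; first by apply/hat_schreierP; rewrite -size_elems elE.
      rewrite /proper_initial /initial elems0 prefix0s/=.
      by apply/eqP => H; have := elE; rewrite -H elems0.
    rewrite ifF; last first.
      by apply/eqP => H; have := elems_seq (l := [:: i]) isT; rewrite H elems0.
    by rewrite -size_elems /elem elems_seq//= subSS subn0.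
  by move=> i; have := ci i 0%N.
have rkE t : hat schreier t -> proper_initial s t ->
    schreier_rank t = ofin ((elem s 0).+1 - #|` t|) /\ (#|` s| < #|` t|)%N.
  move=> ht pst; have st := proper_initial_card pst.
  rewrite /schreier_rank ifF; last first.
    by apply/negbTE; rewrite -cardfs_gt0 (leq_trans _ st).
  by rewrite (initial_elem0 (andP pst).1 s0).
rewrite {2}/schreier_rank (negPf s0); split.
  move=> _ [t [ht pst] <-]; have [-> st] := rkE _ ht pst.
  have tc : (#|` t| <= (elem s 0).+1)%N.
    move/hat_schreierP: ht; rewrite (initial_elem0 (andP pst).1 s0).
    by [].
  have := @ole_ofin ((elem s 0).+1 - #|` t|).+1 ((elem s 0).+1 - #|` s|); apply.
  by move: st tc; lia.
move=> c cP; have := hs; rewrite leq_eqVlt => /predU1P[->|sc]; first by rewrite subnn.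
(* Appending one element above s gives a node with rank exactly one less, which attains the
   supremum. *)
pose q := (\max_(x <- s) x).+1.
have sq x : x \in s -> (x < q)%N.
  by move=> xs; rewrite ltnS; exact: (@leq_bigmax_seq _ _ xpredT).
have i1 : initial s (q |` s)%fset by rewrite /initial elemsU1// prefix_rcons.
have c1 : #|` (q |` s)%fset| = #|` s|.+1.
  by rewrite -!size_elems elemsU1// size_rcons.
have p1 : proper_initial s (q |` s)%fset.
  rewrite /proper_initial i1/=; apply/eqP => H.
  by have := c1; rewrite -H => /eqP; rewrite eqn_leq ltnn andbF.
have h1 : hat schreier (q |` s)%fset.
  by apply/hat_schreierP; rewrite c1 -(initial_elem0 i1 s0).
have [rk1 _] := rkE _ h1 p1.
have -> : ofin ((elem s 0).+1 - #|` s|) = osucc (schreier_rank (q |` s)%fset).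
  by rewrite rk1 c1 -[osucc _]/(ofin (_ - _).+1) -subSn// subSS.
by apply: cP; exists (q |` s)%fset.
Qed.

Lemma schreier_order : has_order schreier oomega.
Proof.
split; first by apply/hat_schreierP; rewrite cardfs0.
exists schreier_rank; first exact: schreier_rankP.
by rewrite /schreier_rank eqxx; split; exact: ole_refl.
Qed.

End Schreier.

(** * The spreading model *)

(* The factor 5 ^ (m ^ 2) makes [code] increase with m whatever the level and
   block number, as long as those do not exceed m. *)
Definition code (L i m : nat) : nat := (2 ^ i * 3 ^ L * 5 ^ (m ^ 2))%N.

Lemma lev_code L i m : lev (code L i m) = i.
Proof.
rewrite /lev /code !lognM ?muln_gt0 ?expn_gt0// !lognX.
by rewrite (_ : logn 2 2 = 1)%N// (_ : logn 2 3 = 0)%N// (_ : logn 2 5 = 0)%N//; lia.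
Qed.

Lemma blk_code L i m : blk (code L i m) = L.
Proof.
rewrite /blk /code !lognM ?muln_gt0 ?expn_gt0// !lognX.
by rewrite (_ : logn 3 2 = 0)%N// (_ : logn 3 3 = 1)%N// (_ : logn 3 5 = 0)%N//; lia.
Qed.

(** The factors for level and block number are at most 6^m, which is less than 5^(2m + 1), the ratio
    of 5^((m + 1)^2) to 5^(m^2). *)
Lemma code_lt L i m L' i' m' : (L <= m)%N -> (i <= m)%N -> (m < m')%N ->
  (code L i m < code L' i' m')%N.
Proof.
move=> Lm im mm'.
apply: (@leq_trans (5 ^ (m.+1 ^ 2))); last first.
  apply: (@leq_trans (5 ^ (m' ^ 2))); first by rewrite leq_exp2l// leq_exp2r.
  by rewrite /code leq_pmull// muln_gt0 !expn_gt0.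
have -> : (m.+1 ^ 2 = m ^ 2 + (2 * m).+1)%N by rewrite -addn1 sqrnD; lia.
rewrite expnD [ltnRHS]mulnC /code ltn_pmul2r ?expn_gt0//.
apply: (@leq_ltn_trans (6 ^ m)).
  by rewrite (expnMn 2 3) leq_mul// leq_exp2l.
apply: (@leq_ltn_trans (5 ^ (2 * m))); last by rewrite ltn_exp2l.
by rewrite expnM; case: m {Lm im mm'} => // m; rewrite leq_exp2r.
Qed.

Lemma elem_ge s i : (i < #|` s|)%N -> (elem s 0 <= elem s i)%N /\ (i <= elem s i)%N.
Proof.
elim: i => // i IH si; have [e0 ei] := IH (ltnW si).
have ii : (elem s i < elem s i.+1)%N by apply: elem_ltn.
by split; [exact: leq_trans e0 (ltnW ii) | exact: leq_ltn_trans ei ii].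
Qed.

Section SpreadingModel.
Variable R : realType.

(* For s in the family the bound on [lev n] amounts to [lev n < |s|]; written
   with [elem s 0] it makes [branch s] bounded for every s. *)
Definition branch (s : {fset nat}) : nat -> R^o := fun n =>
  ((lev n <= elem s 0)%N && (n == code (elem s 0) (lev n) (elem s (lev n))))%:R.

Lemma branch_neq0 s n : branch s n != 0 ->
  (lev n <= elem s 0)%N /\ n = code (elem s 0) (lev n) (elem s (lev n)).
Proof.
by rewrite /branch pnatr_eq0 eqb0 negbK => /andP[? /eqP].
Qed.

Lemma branch_qf_le1 s g : space_gauges R g -> qf g (branch s) <= 1.
Proof.
case=> [[N ->]|[cs ccs ->]]; last first.
  apply: branch_collection_le1 => //.
  - by move=> t; rewrite /branch; case: (_ && _); rewrite ?normr1 ?normr0.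
  - by move=> t u /branch_neq0[_ ->] /branch_neq0[_ ->]; rewrite !blk_code.
  - by move=> t u /branch_neq0[_ tE] /branch_neq0[_ uE] tu; rewrite tE uE tu.
(* The support has at most L + 1 nodes, each of weight (L + 1)^-2. *)
set L := elem s 0; pose w : R := (L.+1%:R ^+ 2)^-1.
have w0 : 0 <= w by rewrite invr_ge0 sqr_ge0.
pose cd i := code L i (elem s i).
rewrite qf_wgauge.
apply: (@le_trans _ _ (\sum_(0 <= n < N) \sum_(i < L.+1) (if n == cd i then w else 0))).
  rewrite ler_sum// => n _; have [->|/branch_neq0[nL nE]] := eqVneq (branch s n) 0.
    by rewrite expr0n mulr0 sumr_ge0// => i _; case: ifP.
  have lL : (lev n < L.+1)%N by rewrite ltnS.
  rewrite (bigD1 (Ordinal lL))//= /cd -nE eqxx -[leLHS]addr0 lerD//.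
    rewrite /branch nL -nE eqxx expr1n mulr1 {1}nE blk_code.
    by rewrite /w.
  by rewrite sumr_ge0// => i _; case: ifP.
rewrite exchange_big/=; apply: (@le_trans _ _ (\sum_(i < L.+1) w)).
  apply: ler_sum => i _; have [iN|iN] := boolP (cd i \in index_iota 0 N).
    rewrite (bigD1_seq (cd i))//= ?iota_uniq// eqxx big1 ?addr0//.
    by move=> n /negPf ->.
  rewrite big_seq big1 // => n nN; rewrite ifF//.
  by apply: contraNF iN => /eqP <-.
rewrite sumr_const card_ord -mulr_natl /w expr2 invfM mulrA mulfV ?mul1r ?pnatr_eq0//.
by rewrite invf_le1 ?ltr0n// ler1n.
Qed.

Lemma branch_bounded s : branch s \in gbounded (space_gauges R).
Proof.
apply/gboundedP; exists 1; first exact: ler01.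
by move=> g Gg; rewrite expr1n; exact: branch_qf_le1.
Qed.

Definition bvec s : gspace (space_gauges R) := GSpace (branch_bounded s).

Lemma bvec_norm s : `|bvec s| <= 1.
Proof.
by apply: gnorm_le => [|g Gg]; rewrite ?ler01// expr1n; exact: branch_qf_le1.
Qed.

Lemma branch_code s L i : (i <= elem s 0)%N ->
  branch s (code L i (elem s i)) = (L == elem s 0)%:R.
Proof.
move=> iL; rewrite /branch lev_code iL/=; congr (nat_of_bool _)%:R.
by apply/eqP/eqP => [/(congr1 blk)|->//]; rewrite !blk_code.
Qed.

Lemma branch_code_neq s L i m : L != elem s 0 -> branch s (code L i m) = 0.
Proof.
move=> Ls; rewrite /branch lev_code; case: andP => // -[_ /eqP /(congr1 blk)].
by rewrite !blk_code => LE; rewrite LE eqxx in Ls.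
Qed.

(** Take the atom whose rows collect the nodes of levels 0, ..., (k + 1)^2 - 1. The minima of the
    s_j differ, so the branches have distinct block numbers and every row sum is the sum of the
    |a_j|; averaging over the (k + 1)^2 rows returns its square. *)
Lemma bvec_sum_ge k (s : k.+1.-tuple {fset nat}) (a : 'I_k.+1 -> R) :
  (forall j, schreier (tnth s j)) -> plegma s ->
  (k.+1 ^ 2 <= elem (tnth s ord0) 0)%N ->
  \sum_(j < k.+1) `|a j| <= `|\sum_(j < k.+1) a j *: bvec (tnth s j)|.
Proof.
move=> Fs [s0 ps1 ps2] sk.
pose e j i := elem (tnth s j) i.
have lead_lt (i j : 'I_k.+1) : (i < j)%N -> (e i 0 < e j 0)%N.
  by move=> ij; apply: ps1; rewrite // leq_min !cardfs_gt0 !s0.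
have lead_inj (i j : 'I_k.+1) : e i 0 = e j 0 -> i = j.
  move=> eij; apply/val_inj/eqP; rewrite eqn_leq; apply/andP; split;
  by rewrite leqNgt; apply/negP => /lead_lt; rewrite eij ltnn.
have lead_ge j : (k.+1 ^ 2 <= e j 0)%N.
  apply: (leq_trans sk); have [j0|j0] := posnP j.
    by have -> : j = ord0 by exact: val_inj.
  exact: ltnW (lead_lt ord0 j j0).
(* Since |s_j| = min s_j + 1, the condition on the minima provides all levels used, and one more for
   the comparison of successive rows. *)
have inS j i : (i <= k.+1 ^ 2)%N -> (i < #|` tnth s j|)%N.
  by move=> ik; rewrite (Fs j) ltnS (leq_trans ik)//; exact: lead_ge.
pose row i := [seq code (e j 0) i (e j i) | j <- enum 'I_k.+1].
pose C : atom := (k, [seq row i | i <- iota 0 (k.+1 ^ 2)]).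
pose y := \sum_(j < k.+1) a j *: bvec (tnth s j).
have okC : atom_ok C.
  split; first by rewrite /= size_map size_iota.
    move=> _ /mapP[i _ ->]; split.
    - rewrite map_inj_uniq ?enum_uniq// => j j' /(congr1 blk).
      by rewrite !blk_code => /lead_inj.
    - by rewrite size_map size_enum_ord.
    - by move=> _ _ /mapP[j _ ->] /mapP[j' _ ->]; rewrite !lev_code.
  change (is_true (pairwise (allrel ltn) (map row (iota 0 (k.+1 ^ 2))))).
  rewrite pairwise_map; have := iota_ltn_sorted 0 (k.+1 ^ 2).
  rewrite (sorted_pairwise ltn_trans).
  apply: (@sub_in_pairwise _ [pred i | i < k.+1 ^ 2]%N); last first.
    by apply/allP => i; rewrite mem_iota add0n.
  move=> i i'; rewrite !inE => ik ik' ii'.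
  apply/allrelP => _ _ /mapP[j _ ->] /mapP[j' _ ->].
  have ij := inS j i (ltnW ik); have ij' := inS j' i' (ltnW ik').
  have [e0 ei] := elem_ge ij; apply: code_lt => //.
  (* The second plegma condition gives s_j(i) < s_j'(i + 1) <= s_j'(i'), so the rows are
     successive. *)
  apply: (@leq_trans (e j' i.+1)).
    apply: ps2; rewrite leq_min ij/= -ltnS prednK ?cardfs_gt0//.
    by rewrite (leq_ltn_trans ii').
  by move: ii'; rewrite leq_eqVlt => /predU1P[->//|ii']; rewrite ltnW// elem_ltn.
have yrow i : (i < k.+1 ^ 2)%N -> rowsum (gval y) (row i) = \sum_(j < k.+1) `|a j|.
  move=> ik; rewrite /rowsum big_map big_enum/=; apply: eq_bigr => j _.
  rewrite gval_sum; under eq_bigr do rewrite gvalZ.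
  rewrite (bigD1 j)//= big1 ?addr0.
    by rewrite branch_code ?eqxx ?mulr1// (leq_trans (ltnW ik))//; exact: lead_ge.
  move=> j' jj'; rewrite branch_code_neq ?mulr0//.
  by apply: contraNneq jj' => /lead_inj ->.
have GC : space_gauges R (gauge_of R [:: C]).
  by right; exists [:: C] => //; split=> // D; rewrite inE => /eqP ->.
have := qf_gnorm GC (gvalP y); rewrite qf_gauge_of big_seq1 /aval.
rewrite (_ : C.2 = map row (iota 0 (k.+1 ^ 2)))// big_map big_seq.
rewrite (eq_bigr (fun=> (\sum_(j < k.+1) `|a j|) ^+ 2)); last first.
  by move=> i; rewrite mem_iota add0n /= => ik; rewrite yrow.
rewrite -big_seq big_const_seq count_predT iter_addr_0 size_iota -[X in _ * X]mulr_natl.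
rewrite mulKf ?pnatr_eq0 ?expn_eq0// ler_pXn2r// nnegrE ?gnorm_ge0//.
by rewrite sumr_ge0.
Qed.

(** Polynomials with this norm realise c_00 with the l1 norm, the monomials being the unit vector
    basis. *)
Definition poly_l1 (u : {poly R}) : R := \sum_(i < size u) `|u`_i|.

Lemma poly_l1E (u : {poly R}) n : (size u <= n)%N -> poly_l1 u = \sum_(i < n) `|u`_i|.
Proof.
move=> un; rewrite /poly_l1 (big_ord_widen n (fun i => `|u`_i|) un) big_mkcond/=.
apply: eq_bigr => i _; case: ltnP => // ui.
by rewrite nth_default// normr0.
Qed.

Lemma coef_sumXn n (a : 'I_n -> R) (i : 'I_n) : (\sum_(j < n) a j *: 'X^j)`_i = a i.
Proof.
rewrite coef_sum (bigD1 i)//= coefZ coefXn eqxx mulr1 big1 ?addr0// => j ji.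
rewrite coefZ coefXn (_ : _ == _ = false) ?mulr0//.
by apply: contraNF ji => /eqP ij; apply/eqP/val_inj.
Qed.

Lemma poly_l1_sumXn n (a : 'I_n -> R) :
  poly_l1 (\sum_(j < n) a j *: 'X^j) = \sum_(j < n) `|a j|.
Proof.
rewrite (@poly_l1E _ n).
  by apply: eq_bigr => i _; rewrite coef_sumXn.
apply/leq_sizeP => i ni; rewrite coef_sum big1// => j _.
by rewrite coefZ coefXn gtn_eqF ?mulr0// (leq_trans (ltn_ord j)).
Qed.

Lemma poly_l1_seminorm : is_seminorm poly_l1.
Proof.
split=> [u v|a u].
  pose n := maxn (size u) (size v).
  rewrite !(@poly_l1E _ n) ?leq_maxl ?leq_maxr ?size_polyD//.
  by rewrite -big_split/= ler_sum// => i _; rewrite coefD ler_normD.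
rewrite (@poly_l1E _ (size u)) ?size_scale_leq// /poly_l1 mulr_sumr.
by apply: eq_bigr => i _; rewrite coefZ normrM.
Qed.

Lemma poly_hamel : hamel_basis (fun n => 'X^n : {poly R}).
Proof.
split=> [n a a0 i|u]; first by rewrite -(coef_sumXn a) a0 coef0.
by exists (size u), (fun i => u`_i); rewrite -[LHS]coefK poly_def.
Qed.

Lemma gspace_l1 : admits_l1 (gspace (space_gauges R)) oomega.
Proof.
(* With m l = (l + 1)^2 the condition on s_1(1) yields the minimum (k + 1)^2 required by
   [bvec_sum_ge], as k <= l. *)
exists schreier, (fun l => l.+1 ^ 2)%N, bvec; split.
- exact: schreier_regular_thin.
- exact: schreier_order.
- by move=> i j ij; rewrite ltn_exp2r.
exists {poly R}, poly_l1, (fun n => 'X^n); split.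
- exact: poly_l1_seminorm.
- exact: poly_hamel.
(* The two norms agree exactly; any positive null sequence will do. *)
- exists harmonic; split; [exact: harmonic_gt0 | exact: cvg_harmonic|].
  move=> k l s a kl Fs ps ms _.
  rewrite poly_l1_sumXn.
  have -> : `|\sum_(j < k.+1) a j *: bvec (tnth s j)| = \sum_(j < k.+1) `|a j|.
    apply/eqP; rewrite eq_le bvec_sum_ge ?andbT//.
    + apply: (le_trans (ler_norm_sum _ _ _)); apply: ler_sum => j _.
      by rewrite normrZ -[leRHS]mulr1 ler_wpM2l// bvec_norm.
    + by move=> j; exact: (Fs j).1.
    + by apply: leq_trans ms; rewrite leq_exp2r.
  by rewrite subrr normr0 ltW// harmonic_gt0.
- exists 1, 1; split=> // n a; rewrite poly_l1_sumXn !mul1r; split; exact: lexx.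
Qed.

End SpreadingModel.

Theorem theorem0p33 (R : realType) :
  exists (X : completeNormedModType R) (b : nat -> X),
    [/\ reflexive_space X,
        unconditional_basis b,
        admits_l1 X oomega
      & forall xi : cord, ole (ofin 1) xi -> ~ admits_l1_plegma_block b xi].
Proof.
exists (gspace (space_gauges R)), (gbasis (space_gauges R)).
have K0 : (0 : R) <= 3 by [].
split.
- exact: (gspace_reflexive (@space_tails_vanish R) K0 (@space_upper2 R)).
- exact: gbasis_unconditional (@space_tails_vanish R).
- exact: gspace_l1.
- exact: (no_plegma_block_l1 (@space_tails_vanish R) K0 (@space_upper2 R)).
Qed.
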